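(* Let $R>0$, let $B_R(0)\subset\mathbb{R}^2$ be the open ball of radius $R$ centered at the origin, let $f\in C^2(B_R(0))$ be a function with $0<m\le f\le M$ in $B_R(0)$ for constants $m,M$, and let $u\in C^4(B_R(0))$ be a convex solution of the prescribed Gauss curvature equation $$\frac{\det\nabla^2u}{(1+|\nabla u|^2)^2}=f(x)\quad\text{in } B_R(0).$$ Then $$|\nabla^2u(0)|\le C,$$ where $C$ is a positive constant depending only on $m$, $M$, $R$, $\sup_{B_R(0)}|\nabla f|$, $\sup_{B_R(0)}|\nabla^2f|$ and $\sup_{B_R(0)}|\nabla u|$.
   Context: $\nabla u$ and $\nabla^2u$ denote the gradient and the Hessian matrix of $u$. The phrase ''depending only on'' means that the same constant $C$ works for all $u$ and $f$ satisfying the hypotheses with the same values (assumed finite) of the listed quantities. *)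

(* Defs.v *)
From Stdlib Require Import Reals.
From Coquelicot Require Import Coquelicot.
Open Scope R_scope.

Definition norm2 (a b : R) : R := sqrt (a ^ 2 + b ^ 2).

Definition in_ball (r x y : R) : Prop := norm2 x y < r.

(* Functions on the ball are represented by total functions of the two
   coordinates; only their values on the ball are ever constrained or used,
   since the ball is open and derivatives are local. *)

(* [ex_diff_n g k x y] says that all iterated partial derivatives of g of order
   at most k exist at (x, y) and are jointly continuous there. *)
Definition C_on_ball (k : nat) (r : R) (g : R -> R -> R) : Prop :=
  forall x y, in_ball r x y -> ex_diff_n g k x y.

Definition convex_on_ball (r : R) (g : R -> R -> R) : Prop :=
  forall x1 y1 x2 y2 t,
    in_ball r x1 y1 -> in_ball r x2 y2 -> 0 <= t <= 1 ->
    g (t * x1 + (1 - t) * x2) (t * y1 + (1 - t) * y2)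
      <= t * g x1 y1 + (1 - t) * g x2 y2.

Definition D1 (g : R -> R -> R) (x y : R) : R := Derive (fun z => g z y) x.
Definition D2 (g : R -> R -> R) (x y : R) : R := Derive (fun z => g x z) y.

Definition grad_norm (g : R -> R -> R) (x y : R) : R :=
  norm2 (D1 g x y) (D2 g x y).

Definition hess_det (g : R -> R -> R) (x y : R) : R :=
  D1 (D1 g) x y * D2 (D2 g) x y - D1 (D2 g) x y * D2 (D1 g) x y.

(* Euclidean (Frobenius) norm of the Hessian matrix. *)
Definition hess_norm (g : R -> R -> R) (x y : R) : R :=
  sqrt (D1 (D1 g) x y ^ 2 + D1 (D2 g) x y ^ 2
        + D2 (D1 g) x y ^ 2 + D2 (D2 g) x y ^ 2).

(* The supremum of h over the ball is finite and equal to s. *)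
Definition is_sup_on_ball (r : R) (h : R -> R -> R) (s : R) : Prop :=
  is_lub (fun v => exists x y, in_ball r x y /\ v = h x y) s.

Definition gauss_curvature_eq (r : R) (u f : R -> R -> R) : Prop :=
  forall x y, in_ball r x y ->
    hess_det u x y / (1 + grad_norm u x y ^ 2) ^ 2 = f x y.

(* Main.v *)
Require Import Defs.
From Stdlib Require Import Reals Lra Psatz Classical ClassicalEpsilon.
From Coquelicot Require Import Coquelicot.
Open Scope R_scope.

(** The proof is a Pogorelov-type maximum principle in a section of [u].

    Write [v] for [u] minus its tangent plane at the origin, [T] for the Laplacian
    [u_11 + u_22], and [N] for the linearised determinant
    [N w = u_22 w_11 - 2 u_12 w_12 + u_11 w_22].

    _Strict convexity_ ([uniform_strict_convexity]).  In two dimensions the bound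
    [det (D^2 u) >= m] together with a gradient bound forces [v >= del] for
    [|x| >= r / 2], where [del > 0] depends only on [m], [r] and the gradient bound.  If
    [v < del] at such a point, then [v] is at most [del + G t] at distance [t] from
    the segment that joins this point to the origin.  An explicit barrier with a
    [tau ln tau] profile, compared with [v] by looking at an interior maximum of the
    difference, then pushes [v] below zero.

    _Interior bound_ ([max_point_bound]).  Let [eta = del - v].  By strict convexity
    [T * eta] attains its maximum over the square of half-side [r / 2] at an interior
    point where [eta > 0].  There the gradient of [T * eta] vanishes and
    [N (T * eta) <= 0].  Since [N eta = - 2 psi], with [psi = f (1 + |Du|^2)^2], the
    cut-off costs only a term of order [T].  The equation differentiated twice gives
    [N T] ([laplace_curvature_equation]): the quadratic terms in the third
    derivatives are evaluated exactly by [third_order_identity], and they absorb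
    [2 <DT, D eta>], the product being that of the cofactor matrix of [D^2 u].  The Laplacian of [psi] contains
    [4 f (1 + |Du|^2) |D^2 u|^2], which is of order [T ^ 2]; every other term
    multiplying [eta] is nonnegative, or at most linear in [T], or becomes so through
    the first-order condition.  Hence [eta * T] is bounded at the maximum, so
    [T 0 * del <= max (T * eta)] bounds [T] at the origin, and for a convex function
    [T] dominates the norm of the Hessian. *)

(** * Maxima over rectangles *)

(** The parameter [e] and the radius of the neighbourhood on which [P e] holds are merged
    into one positive number at each point; compactness bounds finitely many, hence all
    relevant, of these numbers from below. *)
Lemma rectangle_uniform (P : R -> R -> R -> Prop) (a b c d : R) :
  (forall e e' x y, 0 < e' <= e -> P e x y -> P e' x y) ->
  (forall x y, a <= x <= b -> c <= y <= d ->
     exists e, 0 < e /\ locally_2d (P e) x y) ->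
  exists e, 0 < e /\ forall x y, a <= x <= b -> c <= y <= d -> P e x y.
Proof.
  intros Hmono Hloc.
  assert (Hd : forall x y, exists e : posreal, a <= x <= b -> c <= y <= d ->
    forall u v, Rabs (u - x) < e -> Rabs (v - y) < e -> P e u v).
  { intros x y.
    destruct (classic (a <= x <= b /\ c <= y <= d)) as [[Hx Hy]|N].
    - destruct (Hloc x y Hx Hy) as [e [He [[e' He'] H]]]. simpl in H.
      assert (Hm : 0 < Rmin e e') by now apply Rmin_pos.
      exists (mkposreal _ Hm). simpl. intros _ _ u v Hu Hv.
      apply Hmono with e; [split; [exact Hm|apply Rmin_l]|].
      apply H; eapply Rlt_le_trans; eauto; apply Rmin_r.
    - exists (mkposreal 1 Rlt_0_1). intros; tauto. }
  set (delta := fun x y => proj1_sig (constructive_indefinite_description _ (Hd x y))).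
  destruct (compactness_value_2d a b c d delta) as [e He].
  exists e. split; [apply cond_pos|]. intros x y Hx Hy.
  apply NNPP. intros N. apply (He x y Hx Hy). intros [u [v (Hu & Hv & H1 & H2 & H3)]].
  apply N. apply Hmono with (delta u v); [split; [apply cond_pos|exact H3]|].
  unfold delta in *.
  exact (proj2_sig (constructive_indefinite_description _ (Hd u v)) Hu Hv x y H1 H2).
Qed.

(** Both steps use [rectangle_uniform]: the bound [/ e] shows that the supremum is finite,
    and if it were not attained the gap [e] below it could be chosen uniformly. *)
Lemma rectangle_max (g : R -> R -> R) (a b c d : R) :
  a <= b -> c <= d ->
  (forall x y, a <= x <= b -> c <= y <= d -> continuity_2d_pt g x y) ->
  exists x0 y0, (a <= x0 <= b /\ c <= y0 <= d) /\
    forall x y, a <= x <= b -> c <= y <= d -> g x y <= g x0 y0.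
Proof.
  intros Hab Hcd Hg.
  set (E := fun v => exists x y, (a <= x <= b /\ c <= y <= d) /\ v = g x y).
  destruct (rectangle_uniform (fun e x y => g x y <= / e) a b c d) as [e [He Hb]].
  { intros e e' x y Hee H. apply Rle_trans with (/ e); [exact H|].
    apply Rinv_le_contravar; lra. }
  { intros x y Hx Hy.
    assert (Hp : 0 < Rabs (g x y) + 1) by (pose proof (Rabs_pos (g x y)); lra).
    exists (/ (Rabs (g x y) + 1)). split; [now apply Rinv_0_lt_compat|].
    destruct (Hg x y Hx Hy (mkposreal 1 Rlt_0_1)) as [e H].
    exists e. intros u v Hu Hv. specialize (H u v Hu Hv). simpl in H.
    apply Rabs_def2 in H. rewrite Rinv_inv.
    pose proof (Rle_abs (g x y)). lra. }
  destruct (completeness E) as [S [HS1 HS2]].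
  { exists (/ e). intros v [x [y [[Hx Hy] ->]]]. now apply Hb. }
  { exists (g a c), a, c. lra. }
  apply NNPP. intros N.
  assert (Hlt : forall x y, a <= x <= b -> c <= y <= d -> g x y < S).
  { intros x y Hx Hy.
    assert (HxS : g x y <= S) by (apply HS1; exists x, y; tauto).
    destruct (Rle_lt_or_eq_dec _ _ HxS) as [H|H]; [exact H|].
    exfalso. apply N. exists x, y. split; [tauto|]. intros u v Hu Hv.
    rewrite H. apply HS1. exists u, v; tauto. }
  destruct (rectangle_uniform (fun e x y => g x y <= S - e) a b c d) as [s [Hs Hgap]].
  { intros; lra. }
  { intros x y Hx Hy. specialize (Hlt x y Hx Hy).
    assert (Hp : 0 < (S - g x y) / 2) by lra.
    exists ((S - g x y) / 2). split; [exact Hp|].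
    destruct (Hg x y Hx Hy (mkposreal _ Hp)) as [r H].
    exists r. intros u v Hu Hv. specialize (H u v Hu Hv). simpl in H.
    apply Rabs_def2 in H. lra. }
  assert (S <= S - s); [|lra].
  apply HS2. intros v [x [y [[Hx Hy] ->]]]. now apply Hgap.
Qed.

(** * Second-order calculus along lines *)

(** The data of a second derivative test in one variable.  Sums and products are formed
    at this level, so that an expression in two variables such as [T * eta] is treated
    one line at a time, from the jets of its factors. *)
Definition jet2 (g g1 : R -> R) (g2 x : R) : Prop :=
  locally x (fun z => is_derive g z (g1 z)) /\ is_derive g1 x g2.

Lemma Derive_eta (g : R -> R) (x l : R) : is_derive g x l -> Derive (fun z => g z) x = l.
Proof. exact (is_derive_unique g x l). Qed.

Lemma is_derive_unique_loc (g h : R -> R) (x l l' : R) :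
  locally x (fun z => g z = h z) -> is_derive g x l -> is_derive h x l' -> l = l'.
Proof.
  intros E Hg Hh. rewrite <- (is_derive_unique _ _ _ Hg), <- (is_derive_unique _ _ _ Hh).
  now apply Derive_ext_loc.
Qed.

Lemma jet2_plus g g1 g2 h h1 h2 x :
  jet2 g g1 g2 x -> jet2 h h1 h2 x ->
  jet2 (fun z => g z + h z) (fun z => g1 z + h1 z) (g2 + h2) x.
Proof.
  intros [Hg Hg2] [Hh Hh2]. split; [|now apply (is_derive_plus g1 h1)].
  generalize (filter_and _ _ Hg Hh). apply filter_imp. intros z [Zg Zh].
  now apply (is_derive_plus g h).
Qed.

Lemma jet2_minus g g1 g2 h h1 h2 x :
  jet2 g g1 g2 x -> jet2 h h1 h2 x ->
  jet2 (fun z => g z - h z) (fun z => g1 z - h1 z) (g2 - h2) x.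
Proof.
  intros [Hg Hg2] [Hh Hh2]. split; [|now apply (is_derive_minus g1 h1)].
  generalize (filter_and _ _ Hg Hh). apply filter_imp. intros z [Zg Zh].
  now apply (is_derive_minus g h).
Qed.

Lemma jet2_mult g g1 g2 h h1 h2 x :
  jet2 g g1 g2 x -> jet2 h h1 h2 x ->
  jet2 (fun z => g z * h z) (fun z => g1 z * h z + g z * h1 z)
    (g2 * h x + 2 * g1 x * h1 x + g x * h2) x.
Proof.
  intros [Hg Hg2] [Hh Hh2]. split.
  - generalize (filter_and _ _ Hg Hh). apply filter_imp. intros z [Zg Zh].
    auto_derive; [repeat split; eexists; eassumption|].
    rewrite (Derive_eta _ _ _ Zg), (Derive_eta _ _ _ Zh). ring.
  - apply locally_singleton in Hg, Hh.
    auto_derive; [repeat split; eexists; eassumption|].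
    rewrite (Derive_eta _ _ _ Hg), (Derive_eta _ _ _ Hh), (Derive_eta _ _ _ Hg2), (Derive_eta _ _ _ Hh2).
    ring.
Qed.

Lemma locally_0_Rabs (P : R -> Prop) e :
  0 < e -> (forall s, Rabs s < e -> P s) -> locally 0 P.
Proof.
  intros He H. exists (mkposreal e He). intros s Hs. apply H.
  replace s with (s + - 0) by ring. exact Hs.
Qed.

Lemma locally_2d_line (P : R -> R -> Prop) x y v w :
  locally_2d P x y -> locally 0 (fun s => P (x + s * v) (y + s * w)).
Proof.
  intros [d Hd].
  assert (Hk : 0 < Rabs v + Rabs w + 1) by (pose proof (Rabs_pos v); pose proof (Rabs_pos w); lra).
  apply (locally_0_Rabs _ (d / (Rabs v + Rabs w + 1))).
  { apply Rdiv_lt_0_compat; [apply cond_pos|exact Hk]. }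
  intros s Hs.
  assert (Hs2 : Rabs s * (Rabs v + Rabs w + 1) < d).
  { replace (pos d) with (d / (Rabs v + Rabs w + 1) * (Rabs v + Rabs w + 1)) by (field; lra).
    apply Rmult_lt_compat_r; lra. }
  pose proof (Rabs_pos s); pose proof (Rabs_pos v); pose proof (Rabs_pos w).
  apply Hd.
  - replace (x + s * v - x) with (s * v) by ring. rewrite Rabs_mult. nra.
  - replace (y + s * w - y) with (s * w) by ring. rewrite Rabs_mult. nra.
Qed.

(** If the second derivative were positive, the first derivative, which vanishes at
    the maximum, would be positive just to the right of it. *)
Lemma second_derivative_test (phi dphi : R -> R) (d : R) :
  jet2 phi dphi d 0 ->
  locally 0 (fun t => phi t <= phi 0) ->
  dphi 0 = 0 /\ d <= 0.
Proof.
  intros [[e1 H1] H2] [e2 H3].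
  assert (Hb : forall e : posreal, forall t, Rabs t < e -> ball (0:R) e t).
  { intros e t Ht. unfold ball; simpl; unfold AbsRing_ball, abs, minus, plus, opp; simpl.
    now replace (t + - 0) with t by ring. }
  set (e := Rmin e1 e2).
  assert (He : 0 < e) by (apply Rmin_pos; apply cond_pos).
  assert (He1 : e <= e1) by apply Rmin_l.
  assert (He2 : e <= e2) by apply Rmin_r.
  assert (D0 : derivable_pt_lim phi 0 (dphi 0)).
  { apply is_derive_Reals, H1, Hb. rewrite Rabs_R0. apply cond_pos. }
  assert (Z : dphi 0 = 0).
  { set (pr := exist _ (dphi 0) D0 : derivable_pt phi 0).
    change (dphi 0) with (derive_pt phi 0 pr).
    apply (deriv_maximum phi (-e) e 0 pr); try lra.
    intros x Hx1 Hx2. apply H3, Hb. apply Rabs_def1; lra. }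
  split; [exact Z|].
  apply Rnot_lt_le; intros Hd.
  apply is_derive_Reals in H2.
  destruct (H2 (d/2)) as [e3 H4]; [lra|].
  set (h := Rmin e e3 / 2).
  assert (Hm : 0 < Rmin e e3) by (apply Rmin_pos; [lra|apply cond_pos]).
  assert (Hm1 : Rmin e e3 <= e) by apply Rmin_l.
  assert (Hm2 : Rmin e e3 <= e3) by apply Rmin_r.
  destruct (MVT_cor2 phi dphi 0 h) as [c [Hc1 Hc2]].
  { unfold h; lra. }
  { intros c Hc. apply is_derive_Reals, H1, Hb. apply Rabs_def1; unfold h in *; lra. }
  assert (P : phi h <= phi 0).
  { apply H3, Hb. apply Rabs_def1; unfold h in *; lra. }
  assert (Q : Rabs ((dphi (0 + c) - dphi 0) / c - d) < d / 2).
  { apply H4. lra. apply Rabs_def1; unfold h in *; lra. }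
  rewrite Rplus_0_l, Z, Rminus_0_r in Q.
  apply Rabs_def2 in Q.
  assert (Hpos : 0 < dphi c).
  { replace (dphi c) with (dphi c / c * c) by (field; lra). apply Rmult_lt_0_compat; lra. }
  assert (0 < dphi c * (h - 0)) by (apply Rmult_lt_0_compat; lra).
  lra.
Qed.

Lemma in_ball_sqr r x y : 0 < r -> (in_ball r x y <-> x ^ 2 + y ^ 2 < r ^ 2).
Proof.
  intros Hr. unfold in_ball, norm2. split; intros H.
  - rewrite <- (sqrt_pow2 r) in H by lra. apply sqrt_lt_0_alt in H. exact H.
  - rewrite <- (sqrt_pow2 r) by lra. apply sqrt_lt_1_alt. split; [nra|exact H].
Qed.

Lemma in_ball_open r x y : in_ball r x y -> locally_2d (in_ball r) x y.
Proof.
  intros H.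
  assert (Hr : 0 < r) by (eapply Rle_lt_trans; [apply sqrt_pos|exact H]).
  assert (C : continuity_2d_pt (fun a b => a * a + b * b) x y).
  { apply continuity_2d_pt_plus; apply continuity_2d_pt_mult;
    (apply continuity_2d_pt_id1 || apply continuity_2d_pt_id2). }
  apply in_ball_sqr in H; [|exact Hr].
  assert (He : 0 < r ^ 2 - (x ^ 2 + y ^ 2)) by lra.
  destruct (C (mkposreal _ He)) as [d Hd].
  exists d. intros a b Ha Hb. apply in_ball_sqr; [exact Hr|].
  specialize (Hd a b Ha Hb). simpl in Hd. apply Rabs_def2 in Hd. simpl. lra.
Qed.

Lemma C_on_ball_D1 k r g : C_on_ball (S k) r g -> C_on_ball k r (D1 g).
Proof. intros H x y B. exact (proj1 (proj2 (proj2 (proj2 (H x y B))))). Qed.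

Lemma C_on_ball_D2 k r g : C_on_ball (S k) r g -> C_on_ball k r (D2 g).
Proof. intros H x y B. exact (proj2 (proj2 (proj2 (proj2 (H x y B))))). Qed.

Lemma C_on_ball_pred k r g : C_on_ball (S k) r g -> C_on_ball k r g.
Proof. intros H x y B. apply ex_diff_n_m with (S k); auto. Qed.

Lemma C_on_ball_continuity k r g x y :
  C_on_ball k r g -> in_ball r x y -> continuity_2d_pt g x y.
Proof. intros H B. specialize (H x y B). destruct k; exact (proj1 H). Qed.

Lemma C_on_ball_is_D1 k r g x y :
  C_on_ball (S k) r g -> in_ball r x y -> is_derive (fun z => g z y) x (D1 g x y).
Proof. intros H B. apply Derive_correct. exact (proj1 (proj2 (H x y B))). Qed.

Lemma C_on_ball_is_D2 k r g x y :
  C_on_ball (S k) r g -> in_ball r x y -> is_derive (fun z => g x z) y (D2 g x y).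
Proof. intros H B. apply Derive_correct. exact (proj1 (proj2 (proj2 (H x y B)))). Qed.

Lemma C_on_ball_differentiable k r g x y :
  C_on_ball (S k) r g -> in_ball r x y ->
  differentiable_pt_lim g x y (D1 g x y) (D2 g x y).
Proof.
  intros H B. apply filterdiff_differentiable_pt_lim.
  apply is_derive_filterdiff with (dfx := D1 g).
  - apply locally_2d_locally with (P := fun a b => is_derive (fun z => g z b) a (D1 g a b)).
    eapply locally_2d_impl; [|exact (in_ball_open r x y B)].
    apply locally_2d_forall. intros a b. now apply (C_on_ball_is_D1 k).
  - now apply (C_on_ball_is_D2 k r).
  - apply continuity_2d_pt_filterlim.
    apply (C_on_ball_continuity k r); [now apply C_on_ball_D1|exact B].
Qed.

Lemma is_derive_line k r g x y v w t :
  C_on_ball (S k) r g -> in_ball r (x + t * v) (y + t * w) ->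
  is_derive (fun s => g (x + s * v) (y + s * w)) t
    (D1 g (x + t * v) (y + t * w) * v + D2 g (x + t * v) (y + t * w) * w).
Proof.
  intros H B. apply is_derive_Reals.
  apply (derivable_pt_lim_comp_2d g (fun s => x + s * v) (fun s => y + s * w)).
  - now apply (C_on_ball_differentiable k r).
  - apply is_derive_Reals. auto_derive; [easy|ring].
  - apply is_derive_Reals. auto_derive; [easy|ring].
Qed.

Lemma D12_comm k r g x y :
  C_on_ball (S (S k)) r g -> in_ball r x y -> D1 (D2 g) x y = D2 (D1 g) x y.
Proof.
  intros H B.
  pose proof (C_on_ball_D1 _ _ _ H) as H1. pose proof (C_on_ball_D2 _ _ _ H) as H2.
  apply (Schwarz g x y).
  - eapply locally_2d_impl; [|exact (in_ball_open r x y B)].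
    apply locally_2d_forall. intros a b Bab. repeat split.
    + eexists; now apply (C_on_ball_is_D1 (S k) r).
    + eexists; now apply (C_on_ball_is_D2 (S k) r).
    + exists (D1 (D2 g) a b). now apply (C_on_ball_is_D1 k r (D2 g) a b H2).
    + exists (D2 (D1 g) a b). now apply (C_on_ball_is_D2 k r (D1 g) a b H1).
  - apply (C_on_ball_continuity k r (D1 (D2 g))); [now apply C_on_ball_D1|exact B].
  - apply (C_on_ball_continuity k r (D2 (D1 g))); [now apply C_on_ball_D2|exact B].
Qed.

Lemma D1_ext_ball r g h x y :
  (forall a b, in_ball r a b -> g a b = h a b) -> in_ball r x y -> D1 g x y = D1 h x y.
Proof.
  intros E B. apply Derive_ext_loc.
  apply (locally_2d_1d_const_y (fun a b => g a b = h a b)).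
  eapply locally_2d_impl; [|exact (in_ball_open r x y B)].
  apply locally_2d_forall; auto.
Qed.

Lemma D2_ext_ball r g h x y :
  (forall a b, in_ball r a b -> g a b = h a b) -> in_ball r x y -> D2 g x y = D2 h x y.
Proof.
  intros E B. apply Derive_ext_loc.
  apply (locally_2d_1d_const_x (fun a b => g a b = h a b)).
  eapply locally_2d_impl; [|exact (in_ball_open r x y B)].
  apply locally_2d_forall; auto.
Qed.

Lemma line_in_ball r x y v w :
  in_ball r x y -> locally 0 (fun s => in_ball r (x + s * v) (y + s * w)).
Proof. intros B. now apply locally_2d_line, in_ball_open. Qed.

Definition hess_form (g : R -> R -> R) (x y v w : R) : R :=
  D1 (D1 g) x y * v ^ 2 + 2 * D2 (D1 g) x y * v * w + D2 (D2 g) x y * w ^ 2.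

Lemma is_derive_line2 r g x y v w :
  C_on_ball 2 r g -> in_ball r x y ->
  is_derive (fun s => D1 g (x + s * v) (y + s * w) * v + D2 g (x + s * v) (y + s * w) * w) 0
    (hess_form g x y v w).
Proof.
  intros H B.
  assert (B0 : in_ball r (x + 0 * v) (y + 0 * w)) by now rewrite !Rmult_0_l, !Rplus_0_r.
  pose proof (is_derive_line 0 r _ x y v w 0 (C_on_ball_D1 _ _ _ H) B0) as H1.
  pose proof (is_derive_line 0 r _ x y v w 0 (C_on_ball_D2 _ _ _ H) B0) as H2.
  pose proof (is_derive_plus _ _ _ _ _ (is_derive_scal_l _ _ _ v H1)
    (is_derive_scal_l _ _ _ w H2)) as H3.
  rewrite !Rmult_0_l, !Rplus_0_r, (D12_comm 0 r g x y H B) in H3.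
  eapply is_derive_ext; [|replace (hess_form g x y v w) with
    (plus (scal (D1 (D1 g) x y * v + D2 (D1 g) x y * w) v)
      (scal (D2 (D1 g) x y * v + D2 (D2 g) x y * w) w)); [exact H3|]].
  - reflexivity.
  - unfold hess_form, plus, scal; simpl. unfold mult; simpl. ring.
Qed.

Lemma jet2_line r g x y v w :
  C_on_ball 2 r g -> in_ball r x y ->
  jet2 (fun s => g (x + s * v) (y + s * w))
    (fun s => D1 g (x + s * v) (y + s * w) * v + D2 g (x + s * v) (y + s * w) * w)
    (hess_form g x y v w) 0.
Proof.
  intros H B. split; [|now apply (is_derive_line2 r)].
  generalize (line_in_ball r x y v w B). apply filter_imp.
  intros s Bs. now apply (is_derive_line 1 r).
Qed.

Lemma jet2_D1 r g x y :
  C_on_ball 2 r g -> in_ball r x y ->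
  jet2 (fun z => g z y) (fun z => D1 g z y) (D1 (D1 g) x y) x.
Proof.
  intros H B. split.
  - apply (locally_2d_1d_const_y (fun a b => is_derive (fun z => g z b) a (D1 g a b))).
    generalize (in_ball_open r x y B). apply locally_2d_impl, locally_2d_forall.
    intros a b Bab. now apply (C_on_ball_is_D1 1 r).
  - apply (C_on_ball_is_D1 0 r); [now apply C_on_ball_D1|exact B].
Qed.

Lemma jet2_D2 r g x y :
  C_on_ball 2 r g -> in_ball r x y ->
  jet2 (fun z => g x z) (fun z => D2 g x z) (D2 (D2 g) x y) y.
Proof.
  intros H B. split.
  - apply (locally_2d_1d_const_x (fun a b => is_derive (fun z => g a z) b (D2 g a b))).
    generalize (in_ball_open r x y B). apply locally_2d_impl, locally_2d_forall.
    intros a b Bab. now apply (C_on_ball_is_D2 1 r).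
  - apply (C_on_ball_is_D2 0 r); [now apply C_on_ball_D2|exact B].
Qed.

(** Barriers enter through this lemma: [psi] is the restriction to a line of a comparison
    function, which therefore never has to be placed in a two-variable class. *)
Lemma hess_form_le_touching r g x y v w (psi dpsi : R -> R) (d : R) :
  C_on_ball 2 r g -> in_ball r x y -> jet2 psi dpsi d 0 ->
  locally 0 (fun s => g (x + s * v) (y + s * w) - psi s <= g x y - psi 0) ->
  hess_form g x y v w <= d.
Proof.
  intros H B Hpsi Hmax.
  destruct (second_derivative_test _ _ _
    (jet2_minus _ _ _ _ _ _ _ (jet2_line r g x y v w H B) Hpsi)) as [_ Hd]; [|lra].
  revert Hmax. apply filter_imp. intros s Hs. now rewrite !Rmult_0_l, !Rplus_0_r.
Qed.

(** * Convexity *)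

Lemma convex_above_tangent r g x y x' y' :
  C_on_ball 1 r g -> convex_on_ball r g -> in_ball r x y -> in_ball r x' y' ->
  g x y + D1 g x y * (x' - x) + D2 g x y * (y' - y) <= g x' y'.
Proof.
  intros H Hc B B'.
  assert (B0 : in_ball r (x + 0 * (x' - x)) (y + 0 * (y' - y))) by now rewrite !Rmult_0_l, !Rplus_0_r.
  pose proof (is_derive_line 0 r g x y (x' - x) (y' - y) 0 H B0) as Hd.
  apply is_derive_Reals in Hd. rewrite !Rmult_0_l, !Rplus_0_r in Hd.
  set (L := D1 g x y * (x' - x) + D2 g x y * (y' - y)) in *.
  apply Rnot_lt_le; intros Hlt.
  destruct (Hd (L - (g x' y' - g x y))) as [d Hd']; [unfold L; lra|].
  set (h := Rmin d 1 / 2).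
  assert (Hm : 0 < Rmin d 1) by (apply Rmin_pos; [apply cond_pos|lra]).
  pose proof (Rmin_l d 1). pose proof (Rmin_r d 1).
  assert (Hh : 0 < h <= 1 /\ h < d) by (unfold h; lra).
  specialize (Hd' h). rewrite !Rplus_0_l, !Rmult_0_l, !Rplus_0_r in Hd'.
  assert (Hq := Hd' (Rgt_not_eq _ _ (proj1 (proj1 Hh))) (Rabs_def1 _ _ (proj2 Hh) ltac:(lra))).
  pose proof (Hc x' y' x y h B' B ltac:(lra)) as Hcx.
  replace (h * x' + (1 - h) * x) with (x + h * (x' - x)) in Hcx by ring.
  replace (h * y' + (1 - h) * y) with (y + h * (y' - y)) in Hcx by ring.
  apply Rabs_def2 in Hq. destruct Hq as [_ Hq].
  set (z := g (x + h * (x' - x)) (y + h * (y' - y))) in *.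
  assert (Hz : (z - g x y) / h * h = z - g x y) by (field; lra).
  assert (g x' y' - g x y < (z - g x y) / h) by lra.
  assert ((g x' y' - g x y) * h < (z - g x y) / h * h) by (apply Rmult_lt_compat_r; lra).
  lra.
Qed.

(** The tangent plane touches a convex function from below, so the second derivative
    test applies to their difference. *)
Lemma convex_hess_form_ge0 r g x y v w :
  C_on_ball 2 r g -> convex_on_ball r g -> in_ball r x y ->
  0 <= hess_form g x y v w.
Proof.
  intros H Hc B.
  set (L := D1 g x y * v + D2 g x y * w).
  assert (Haff : jet2 (fun s => L * s) (fun _ => L) 0 0).
  { split.
    - apply filter_forall. intros s. auto_derive; [easy|ring].
    - apply (is_derive_const (V := R_NormedModule)). }
  destruct (second_derivative_test _ _ _
    (jet2_minus _ _ _ _ _ _ _ Haff (jet2_line r g x y v w H B))) as [_ Hd]; [|lra].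
  generalize (line_in_ball r x y v w B). apply filter_imp. intros s Bs.
  pose proof (convex_above_tangent r g x y _ _ (C_on_ball_pred _ _ _ H) Hc B Bs) as Ht.
  rewrite !Rmult_0_l, !Rplus_0_r. unfold L. lra.
Qed.

Lemma grad_norm_dot_le g x y b v w :
  grad_norm g x y <= b ->
  D1 g x y * v + D2 g x y * w <= b * norm2 v w.
Proof.
  intros H. apply Rle_trans with (grad_norm g x y * norm2 v w).
  - unfold grad_norm, norm2. rewrite <- sqrt_mult by nra.
    apply Rle_trans with (Rabs (D1 g x y * v + D2 g x y * w)); [apply Rle_abs|].
    rewrite <- sqrt_Rsqr_abs. apply sqrt_le_1_alt. unfold Rsqr.
    pose proof (pow2_ge_0 (D1 g x y * w - D2 g x y * v)). nra.
  - apply Rmult_le_compat_r; [apply sqrt_pos|exact H].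
Qed.

Lemma norm2_unit v w : v ^ 2 + w ^ 2 = 1 -> norm2 v w = 1.
Proof. intros H. unfold norm2. rewrite H. apply sqrt_1. Qed.

Lemma continuity_2d_pt_comp (g X Y : R -> R -> R) x y :
  continuity_2d_pt X x y -> continuity_2d_pt Y x y -> continuity_2d_pt g (X x y) (Y x y) ->
  continuity_2d_pt (fun a b => g (X a b) (Y a b)) x y.
Proof.
  intros HX HY Hg eps. destruct (Hg eps) as [d Hd].
  generalize (locally_2d_and _ _ _ _ (HX d) (HY d)). apply locally_2d_impl, locally_2d_forall.
  intros a b [Ha Hb]. now apply Hd.
Qed.

(** * Uniform strict convexity *)

(** Suppose that [u] exceeds its tangent plane at the origin by less than [del] at a
    point [(x0, y0)] with norm [rho >= r / 2].  Take coordinates [s] along the ray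
    through that point and [t] across it, on the square of side [L = r / 2].  There [V],
    the excess over the tangent plane, satisfies [0 <= V <= tau] with
    [tau = del + G t].  The barrier is [W = tau - k (t) s (L - s)], with [k] a concave
    multiple of [tau ln (E / tau) - del ln (E / del)], where [E] is the value of [tau]
    at [t = L]; so [k] is nonpositive at [t = 0] and [t = L], and [V <= W] on the
    boundary.  At an interior maximum of [V - W] the second derivatives satisfy
    [V_ss <= 2 k <= 2 c tau Lam] and [V_tt <= c G^2 L^2 / (4 tau)]: the factors [tau]
    cancel in the product, which is at least [m], while [c] is of order [1 / Lam], with
    [Lam = ln (E / del)].  For large [Lam] this is impossible, so
    [0 <= V <= W], although [W < 0] at [s = L / 2], [tau = e del]. *)
Lemma uniform_strict_convexity (r m G : R) :
  0 < r -> 0 < m -> 0 < G ->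
  exists del, 0 < del /\ forall u,
    C_on_ball 2 r u -> convex_on_ball r u ->
    (forall x y, in_ball r x y ->
       m <= D1 (D1 u) x y * D2 (D2 u) x y - D2 (D1 u) x y ^ 2) ->
    (forall x y, in_ball r x y -> grad_norm u x y <= G / 2) ->
    forall x y, in_ball r x y -> r / 2 <= norm2 x y ->
      u 0 0 + D1 u 0 0 * x + D2 u 0 0 * y + del <= u x y.
Proof.
  intros Hr Hm HG.
  set (L := r / 2). assert (HL : 0 < L) by (unfold L; lra).
  (* The term [512 G^2 / (m L^2)] contradicts [V_ss V_tt >= m] at the end; the summand 6
     makes [W] negative at one point. *)
  set (Lam0 := 512 * G ^ 2 / (m * L ^ 2) + 6).
  assert (HLam0 : 6 <= Lam0 /\ 512 * G ^ 2 < Lam0 * (m * L ^ 2)).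
  { assert (0 < m * L ^ 2) by (apply Rmult_lt_0_compat; [lra|apply pow_lt; lra]).
    assert (0 <= 512 * G ^ 2 / (m * L ^ 2)) by (apply Rdiv_le_0_compat; [nra|lra]).
    split; [unfold Lam0; lra|].
    replace (Lam0 * (m * L ^ 2)) with (512 * G ^ 2 + 6 * (m * L ^ 2)) by (unfold Lam0; field; nra).
    lra. }
  set (del := G * L * exp (- Lam0)).
  assert (Hdel : 0 < del) by (apply Rmult_lt_0_compat; [nra|apply exp_pos]).
  set (E := del + G * L).
  assert (HE : del < E) by (unfold E; nra).
  set (Lam := ln E - ln del).
  assert (HexpE : del * exp Lam0 <= E).
  { unfold del at 1. rewrite Rmult_assoc, <- exp_plus.
    replace (- Lam0 + Lam0) with 0 by ring. rewrite exp_0. unfold E. lra. }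
  assert (HLam : Lam0 <= Lam).
  { unfold Lam. enough (ln (del * exp Lam0) <= ln E) as Hln.
    - rewrite ln_mult, ln_exp in Hln; [lra|lra|apply exp_pos].
    - apply ln_le; [apply Rmult_lt_0_compat; [lra|apply exp_pos]|exact HexpE]. }
  assert (H7 : 7 * del <= E).
  { apply Rle_trans with (del * exp Lam0); [|exact HexpE].
    assert (1 + Lam0 <= exp Lam0) by (apply exp_ineq1_le). nra. }
  exists del. split; [exact Hdel|].
  intros u Hu Hc Hdet Hgrad x0 y0 B0 Hn.
  apply Rnot_lt_le; intros Hlt.
  assert (B00 : in_ball r 0 0) by (apply in_ball_sqr; [exact Hr|nra]).
  set (P1 := D1 u 0 0) in *. set (P2 := D2 u 0 0) in *. set (u0 := u 0 0) in *.
  set (rho := norm2 x0 y0) in *.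
  assert (Hrho : 0 < rho) by lra.
  assert (Hrho2 : rho ^ 2 = x0 ^ 2 + y0 ^ 2).
  { unfold rho, norm2. rewrite pow2_sqrt; [easy|nra]. }
  set (p := x0 / rho). set (q := y0 / rho).
  assert (Hpq : p ^ 2 + q ^ 2 = 1).
  { unfold p, q. replace ((x0 / rho) ^ 2 + (y0 / rho) ^ 2) with ((x0 ^ 2 + y0 ^ 2) / rho ^ 2) by (field; lra).
    rewrite <- Hrho2. field. lra. }
  set (X := fun s t => s * p - t * q). set (Y := fun s t => s * q + t * p).
  assert (HXY : forall s t, X s t ^ 2 + Y s t ^ 2 = s ^ 2 + t ^ 2).
  { intros s t. replace (X s t ^ 2 + Y s t ^ 2) with ((s ^ 2 + t ^ 2) * (p ^ 2 + q ^ 2)) by (unfold X, Y; ring).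
    rewrite Hpq; ring. }
  assert (HB : forall s t, 0 <= s <= L -> 0 <= t <= L -> in_ball r (X s t) (Y s t)).
  { intros s t Hs Ht. apply in_ball_sqr; [exact Hr|]. rewrite HXY. unfold L in *. nra. }
  set (V := fun s t => u (X s t) (Y s t) - (u0 + P1 * X s t + P2 * Y s t)).
  set (tau := fun t => del + G * t).
  assert (HV0 : forall s t, 0 <= s <= L -> 0 <= t <= L -> 0 <= V s t).
  { intros s t Hs Ht.
    pose proof (convex_above_tangent r u 0 0 _ _ (C_on_ball_pred _ _ _ Hu) Hc B00 (HB s t Hs Ht)).
    unfold V, u0, P1, P2. lra. }
  assert (HVs : forall s, 0 <= s <= L -> V s 0 <= del).
  { intros s Hs.
    assert (Hk : 0 <= s / rho <= 1).
    { split; [apply Rdiv_le_0_compat; lra|]. apply Rmult_le_reg_r with rho; [lra|].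
      replace (s / rho * rho) with s by (field; lra). lra. }
    pose proof (Hc x0 y0 0 0 (s / rho) B0 B00 Hk) as Hcx.
    replace (s / rho * x0 + (1 - s / rho) * 0) with (X s 0) in Hcx by (unfold X, p; field; lra).
    replace (s / rho * y0 + (1 - s / rho) * 0) with (Y s 0) in Hcx by (unfold Y, q; field; lra).
    assert (EX : X s 0 = s / rho * x0) by (unfold X, p; field; lra).
    assert (EY : Y s 0 = s / rho * y0) by (unfold Y, q; field; lra).
    unfold V. set (k := s / rho) in *. fold u0 in Hcx.
    rewrite EX, EY in *.
    assert (k * (u x0 y0 - (u0 + P1 * x0 + P2 * y0)) <= del) by nra. lra. }
  assert (HVt : forall s t, 0 <= s <= L -> 0 <= t <= L -> V s t <= tau t).
  { intros s t Hs Ht.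
    assert (H0 : 0 <= 0 <= L) by lra.
    pose proof (convex_above_tangent r u _ _ _ _ (C_on_ball_pred _ _ _ Hu) Hc (HB s t Hs Ht) (HB s 0 Hs H0)) as Ht1.
    pose proof (grad_norm_dot_le u _ _ _ (- q) p (Hgrad _ _ (HB s t Hs Ht))) as Hg1.
    pose proof (grad_norm_dot_le u _ _ _ q (- p) (Hgrad _ _ B00)) as Hg2.
    rewrite norm2_unit in Hg1 by (rewrite <- Hpq; ring).
    rewrite norm2_unit in Hg2 by (rewrite <- Hpq; ring).
    fold P1 P2 in Hg2. pose proof (HVs s Hs) as Hs0.
    unfold V, tau in *.
    set (d1 := D1 u (X s t) (Y s t)) in *. set (d2 := D2 u (X s t) (Y s t)) in *.
    replace (X s 0 - X s t) with (t * q) in Ht1 by (unfold X; ring).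
    replace (Y s 0 - Y s t) with (- (t * p)) in Ht1 by (unfold Y; ring).
    replace (P1 * X s t) with (P1 * X s 0 - t * (P1 * q)) by (unfold X; ring).
    replace (P2 * Y s t) with (P2 * Y s 0 + t * (P2 * p)) by (unfold Y; ring).
    assert (t * (d1 * - q + d2 * p + (P1 * q + P2 * - p)) <= t * G) by (apply Rmult_le_compat_l; lra).
    lra. }
  set (c := 32 / (L ^ 2 * Lam)).
  assert (HLp : 0 < L ^ 2 * Lam) by (apply Rmult_lt_0_compat; nra).
  assert (Hcp : 0 < c) by (apply Rdiv_lt_0_compat; lra).
  assert (HcL : c * (L ^ 2 * Lam) = 32) by (unfold c; field; nra).
  set (k := fun t => c * (tau t * (ln E - ln (tau t)) - del * Lam)).
  set (W := fun s t => tau t - k t * (s * (L - s))).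
  assert (Htau : forall t, 0 <= t -> del <= tau t) by (intros; unfold tau; nra).
  destruct (rectangle_max (fun s t => V s t - W s t) 0 L 0 L) as (s0 & t0 & [Hs0 Ht0] & Hmax); try lra.
  { intros s t Hs Ht. assert (Hts := Htau t (proj1 Ht)).
    assert (CX : continuity_2d_pt X s t) by (unfold X; apply continuity_2d_pt_minus;
      apply continuity_2d_pt_mult; auto using continuity_2d_pt_id1, continuity_2d_pt_id2, continuity_2d_pt_const).
    assert (CY : continuity_2d_pt Y s t) by (unfold Y; apply continuity_2d_pt_plus;
      apply continuity_2d_pt_mult; auto using continuity_2d_pt_id1, continuity_2d_pt_id2, continuity_2d_pt_const).
    assert (Ct : forall h : R -> R, ex_derive h t -> continuity_2d_pt (fun _ t => h t) s t).
    { intros h Hh. apply (continuity_1d_2d_pt_comp h (fun _ t => t)); [|apply continuity_2d_pt_id2].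
      now apply derivable_continuous_pt, ex_derive_Reals_0. }
    assert (Cs : forall h : R -> R, ex_derive h s -> continuity_2d_pt (fun s _ => h s) s t).
    { intros h Hh. apply (continuity_1d_2d_pt_comp h (fun s _ => s)); [|apply continuity_2d_pt_id1].
      now apply derivable_continuous_pt, ex_derive_Reals_0. }
    unfold V, W. repeat apply continuity_2d_pt_minus.
    - apply continuity_2d_pt_comp; auto. now apply (C_on_ball_continuity 2 r), HB.
    - apply continuity_2d_pt_plus; [apply continuity_2d_pt_plus|];
        [apply continuity_2d_pt_const| |]; apply continuity_2d_pt_mult;
        try assumption; apply continuity_2d_pt_const.
    - apply (Ct tau). unfold tau. auto_derive; easy.
    - apply continuity_2d_pt_mult.
      + apply (Ct k). unfold k, tau in *. auto_derive. lra.
      + apply (Cs (fun s => s * (L - s))). auto_derive; easy. }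
  assert (Hk0 : k 0 = 0) by (unfold k, Lam, tau; rewrite Rmult_0_r, Rplus_0_r; ring).
  assert (HkL : k L <= 0).
  { unfold k, tau. fold E.
    assert (0 < del * Lam) by nra. nra. }
  (* Where [tau = e del], one has [ln (E / tau) = Lam - 1], and the choice of [c] gives
     [k L^2 / 4 >= 4 del], while [tau <= 3 del]. *)
  assert (Hneg : exists t, 0 <= t <= L /\ W (L / 2) t < 0).
  { pose proof exp_le_3. assert (He : 2 < exp 1) by (pose proof (exp_ineq1 1); lra).
    exists ((exp 1 - 1) * del / G).
    assert (Ht : tau ((exp 1 - 1) * del / G) = exp 1 * del) by (unfold tau; field; lra).
    split; [split|].
    - apply Rdiv_le_0_compat; nra.
    - apply Rmult_le_reg_l with G; [lra|].
      replace (G * ((exp 1 - 1) * del / G)) with ((exp 1 - 1) * del) by (field; lra).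
      unfold E in H7. nra.
    - unfold W, k. rewrite Ht, ln_mult, ln_exp by lra.
      replace (ln E - (1 + ln del)) with (Lam - 1) by (unfold Lam; ring).
      assert (Hq : del * (Lam / 2) <= exp 1 * del * (Lam - 1) - del * Lam).
      { replace (exp 1 * del * (Lam - 1) - del * Lam) with (del * (exp 1 * (Lam - 1) - Lam)) by ring.
        apply Rmult_le_compat_l; [lra|]. nra. }
      assert (Hq2 : c * (del * (Lam / 2)) * (L / 2 * (L - L / 2)) = 4 * del).
      { replace (c * (del * (Lam / 2)) * (L / 2 * (L - L / 2))) with (c * (L ^ 2 * Lam) * del / 8) by field.
        rewrite HcL. field. }
      assert (Hq3 : c * (del * (Lam / 2)) * (L / 2 * (L - L / 2)) <=
        c * (exp 1 * del * (Lam - 1) - del * Lam) * (L / 2 * (L - L / 2))).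
      { apply Rmult_le_compat_r; [nra|]. apply Rmult_le_compat_l; lra. }
      nra. }
  destruct Hneg as (t1 & Ht1 & HW1).
  assert (Hpos : W s0 t0 < V s0 t0).
  { pose proof (Hmax (L / 2) t1 ltac:(lra) Ht1) as Hm1. cbv beta in Hm1.
    pose proof (HV0 (L / 2) t1 ltac:(lra) Ht1). lra. }
  pose proof (HVt s0 t0 Hs0 Ht0) as Hle.
  assert (Hkpos : 0 < k t0 * (s0 * (L - s0))) by (unfold W in Hpos; lra).
  assert (Hin : (0 < s0 < L) /\ (0 < t0 < L)).
  { assert (s0 <> 0) by (intros ->; lra).
    assert (s0 <> L) by (intros ->; lra).
    assert (t0 <> 0) by (intros ->; rewrite Hk0 in Hkpos; lra).
    assert (0 < s0 * (L - s0)) by (apply Rmult_lt_0_compat; lra).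
    assert (t0 <> L).
    { intros ->. assert (k L * (s0 * (L - s0)) <= 0 * (s0 * (L - s0))) by (apply Rmult_le_compat_r; lra). lra. }
    lra. }
  destruct Hin as [Hin1 Hin2].
  assert (Htau0 := Htau t0 ltac:(lra)).
  pose proof (HB s0 t0 Hs0 Ht0) as Bm.
  assert (Hss : hess_form u (X s0 t0) (Y s0 t0) p q <= 2 * k t0).
  { apply (hess_form_le_touching r u _ _ p q
     (fun s => u0 + P1 * X (s0 + s) t0 + P2 * Y (s0 + s) t0 + W (s0 + s) t0)
     (fun s => P1 * p + P2 * q - k t0 * (L - 2 * (s0 + s)))); auto; [split|].
    - apply filter_forall. intros s. unfold W, X, Y. auto_derive; [easy|ring].
    - auto_derive; [easy|ring].
    - apply (locally_0_Rabs _ (Rmin s0 (L - s0))); [apply Rmin_pos; lra|].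
      intros s Hs. apply Rabs_def2 in Hs.
      pose proof (Rmin_l s0 (L - s0)). pose proof (Rmin_r s0 (L - s0)).
      pose proof (Hmax (s0 + s) t0 ltac:(lra) Ht0) as Hm1. unfold V in Hm1.
      replace (X s0 t0 + s * p) with (X (s0 + s) t0) by (unfold X; ring).
      replace (Y s0 t0 + s * q) with (Y (s0 + s) t0) by (unfold Y; ring).
      rewrite Rplus_0_r. lra. }
  assert (Htt : hess_form u (X s0 t0) (Y s0 t0) (- q) p <= c * G ^ 2 / tau t0 * (s0 * (L - s0))).
  { apply (hess_form_le_touching r u _ _ (- q) p
     (fun s => u0 + P1 * X s0 (t0 + s) + P2 * Y s0 (t0 + s) + W s0 (t0 + s))
     (fun s => - P1 * q + P2 * p + G - c * G * (ln E - ln (tau (t0 + s)) - 1) * (s0 * (L - s0)))); auto; [split|].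
    - apply (locally_0_Rabs _ t0); [lra|]. intros s Hs. apply Rabs_def2 in Hs.
      assert (Hts := Htau (t0 + s) ltac:(lra)). unfold W, X, Y, k, tau in *.
      auto_derive; [lra|field; lra].
    - unfold tau in *. auto_derive; [rewrite Rplus_0_r; lra|rewrite Rplus_0_r; field; lra].
    - apply (locally_0_Rabs _ (Rmin t0 (L - t0))); [apply Rmin_pos; lra|].
      intros s Hs. apply Rabs_def2 in Hs.
      pose proof (Rmin_l t0 (L - t0)). pose proof (Rmin_r t0 (L - t0)).
      pose proof (Hmax s0 (t0 + s) Hs0 ltac:(lra)) as Hm1. unfold V in Hm1.
      replace (X s0 t0 + s * - q) with (X s0 (t0 + s)) by (unfold X; ring).
      replace (Y s0 t0 + s * p) with (Y s0 (t0 + s)) by (unfold Y; ring).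
      rewrite Rplus_0_r. lra. }
  pose proof (convex_hess_form_ge0 r u _ _ p q Hu Hc Bm) as Hss0.
  pose proof (convex_hess_form_ge0 r u _ _ (- q) p Hu Hc Bm) as Htt0.
  (* [hess_form] in two orthonormal directions: their product is the determinant plus
     the square of the mixed derivative. *)
  assert (Hprod : m <= hess_form u (X s0 t0) (Y s0 t0) p q * hess_form u (X s0 t0) (Y s0 t0) (- q) p).
  { apply Rle_trans with (1 := Hdet _ _ Bm). unfold hess_form.
    set (A := D1 (D1 u) _ _). set (B := D2 (D1 u) _ _). set (C := D2 (D2 u) _ _).
    replace (A * C - B ^ 2) with ((A * C - B ^ 2) * (p ^ 2 + q ^ 2) ^ 2) by (rewrite Hpq; ring).
    pose proof (pow2_ge_0 ((C - A) * p * q + B * (p ^ 2 - q ^ 2))). nra. }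
  assert (Hk2 : 2 * k t0 <= 2 * (c * tau t0 * Lam)).
  { unfold k. assert (ln del <= ln (tau t0)) by (apply ln_le; lra).
    assert (Ha : tau t0 * (ln E - ln (tau t0)) <= tau t0 * Lam) by (apply Rmult_le_compat_l; unfold Lam; lra).
    assert (0 < del * Lam) by nra.
    assert (c * (tau t0 * (ln E - ln (tau t0)) - del * Lam) <= c * (tau t0 * Lam)) by (apply Rmult_le_compat_l; lra).
    lra. }
  assert (Hchi : s0 * (L - s0) <= L ^ 2 / 4) by (pose proof (pow2_ge_0 (s0 - L / 2)); nra).
  assert (Hfin : m <= 2 * (c * tau t0 * Lam) * (c * G ^ 2 / tau t0 * (L ^ 2 / 4))).
  { apply Rle_trans with (1 := Hprod). apply Rmult_le_compat; try lra.
    apply Rle_trans with (1 := Htt). apply Rmult_le_compat_l; [|exact Hchi].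
    apply Rdiv_le_0_compat; [nra|lra]. }
  replace (2 * (c * tau t0 * Lam) * (c * G ^ 2 / tau t0 * (L ^ 2 / 4)))
    with (c * (L ^ 2 * Lam) * c * G ^ 2 / 2) in Hfin by (field; lra).
  rewrite HcL in Hfin.
  assert (m * (L ^ 2 * Lam) <= 512 * G ^ 2).
  { apply Rle_trans with (32 * c * G ^ 2 / 2 * (L ^ 2 * Lam)); [apply Rmult_le_compat_r; lra|].
    replace (32 * c * G ^ 2 / 2 * (L ^ 2 * Lam)) with (16 * (c * (L ^ 2 * Lam)) * G ^ 2) by field.
    rewrite HcL. lra. }
  assert (Lam0 * (m * L ^ 2) <= Lam * (m * L ^ 2)) by (apply Rmult_le_compat_r; nra).
  lra.
Qed.

(** * The differentiated curvature equation *)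

(** Stated in one variable, so that the same computation serves both coordinate
    directions. *)
Lemma curvature_equation_1d (a b c f p q a1 b1 c1 f1 p1 q1 : R -> R)
    (a2 b2 c2 f2 p2 q2 x : R) :
  jet2 a a1 a2 x -> jet2 b b1 b2 x -> jet2 c c1 c2 x -> jet2 f f1 f2 x ->
  jet2 p p1 p2 x -> jet2 q q1 q2 x ->
  locally x (fun z => a z * c z - b z ^ 2 = f z * (1 + p z ^ 2 + q z ^ 2) ^ 2) ->
  let s := 1 + p x ^ 2 + q x ^ 2 in
  let s1 := 2 * (p x * p1 x + q x * q1 x) in
  a1 x * c x + a x * c1 x - 2 * b x * b1 x = f1 x * s ^ 2 + 2 * f x * s * s1 /\
  a2 * c x + a x * c2 + 2 * (a1 x * c1 x - b1 x ^ 2) - 2 * b x * b2 =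
    f2 * s ^ 2 + 4 * s * f1 x * s1 + 2 * f x * s1 ^ 2
    + 4 * f x * s * (p1 x ^ 2 + q1 x ^ 2 + p x * p2 + q x * q2).
Proof.
  intros [Ha Ha2] [Hb Hb2] [Hc Hc2] [Hf Hf2] [Hp Hp2] [Hq Hq2] HE s s1.
  assert (H1 : locally x (fun z =>
    a1 z * c z + a z * c1 z - 2 * b z * b1 z =
    f1 z * (1 + p z ^ 2 + q z ^ 2) ^ 2
      + 4 * f z * (1 + p z ^ 2 + q z ^ 2) * (p z * p1 z + q z * q1 z))).
  { apply locally_locally in HE.
    generalize (filter_and _ _ HE (filter_and _ _ Ha (filter_and _ _ Hb (filter_and _ _ Hc
      (filter_and _ _ Hf (filter_and _ _ Hp Hq)))))).
    apply filter_imp. intros z (E & Za & Zb & Zc & Zf & Zp & Zq).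
    apply (is_derive_unique_loc _ _ z _ _ E); (auto_derive; [repeat split; eexists; eassumption|]);
    rewrite ?(Derive_eta _ _ _ Za), ?(Derive_eta _ _ _ Zb), ?(Derive_eta _ _ _ Zc),
      ?(Derive_eta _ _ _ Zf), ?(Derive_eta _ _ _ Zp), ?(Derive_eta _ _ _ Zq); ring. }
  apply locally_singleton in Ha, Hb, Hc, Hf, Hp, Hq.
  split; [rewrite (locally_singleton _ _ H1); unfold s1, s; ring|].
  assert (H2 := fun l l' => is_derive_unique_loc _ _ x l l' H1).
  match type of H2 with forall l l', is_derive ?g _ _ -> is_derive ?h _ _ -> _ =>
    evar (lg : R); evar (lh : R);
    assert (Lg : is_derive g x lg) by
      (unfold lg; auto_derive; [repeat split; eexists; eassumption|reflexivity]);
    assert (Lh : is_derive h x lh) by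
      (unfold lh; auto_derive; [repeat split; eexists; eassumption|reflexivity])
  end.
  specialize (H2 _ _ Lg Lh). unfold lg, lh in H2.
  rewrite (Derive_eta _ _ _ Ha), (Derive_eta _ _ _ Hb), (Derive_eta _ _ _ Hc),
    (Derive_eta _ _ _ Hf), (Derive_eta _ _ _ Hp), (Derive_eta _ _ _ Hq),
    (Derive_eta _ _ _ Ha2), (Derive_eta _ _ _ Hb2), (Derive_eta _ _ _ Hc2),
    (Derive_eta _ _ _ Hf2), (Derive_eta _ _ _ Hp2), (Derive_eta _ _ _ Hq2) in H2.
  unfold s1, s. lra.
Qed.

Lemma third_comm_112 r u x y :
  C_on_ball 4 r u -> in_ball r x y -> D1 (D2 (D1 u)) x y = D2 (D1 (D1 u)) x y.
Proof. intros Hu B. apply (D12_comm 1 r (D1 u) x y (C_on_ball_D1 _ _ _ Hu) B). Qed.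

Lemma third_comm_122 r u x y :
  C_on_ball 4 r u -> in_ball r x y -> D1 (D2 (D2 u)) x y = D2 (D2 (D1 u)) x y.
Proof.
  intros Hu B. rewrite (D12_comm 1 r (D2 u) x y (C_on_ball_D2 _ _ _ Hu) B).
  apply (D2_ext_ball r); [|exact B]. intros a b Bab. now apply (D12_comm 2 r).
Qed.

Lemma curvature_equation_poly r u f x y :
  C_on_ball 4 r u -> gauss_curvature_eq r u f -> in_ball r x y ->
  D1 (D1 u) x y * D2 (D2 u) x y - D2 (D1 u) x y ^ 2 =
    f x y * (1 + D1 u x y ^ 2 + D2 u x y ^ 2) ^ 2.
Proof.
  intros Hu HE B. rewrite <- (HE x y B). unfold hess_det, grad_norm, norm2.
  rewrite pow2_sqrt by nra. rewrite (D12_comm 2 r u x y Hu B). field. nra.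
Qed.

(** The last identity is the Laplacian of the equation, with the fourth derivatives
    regrouped by symmetry into the linearised determinant [N] applied to [A + C]; the
    right-hand side is the Laplacian of [psi = f (1 + |Du|^2)^2]. *)
Lemma laplace_curvature_equation r u f x y :
  C_on_ball 4 r u -> C_on_ball 2 r f -> gauss_curvature_eq r u f -> in_ball r x y ->
  let A := D1 (D1 u) in let B := D2 (D1 u) in let C := D2 (D2 u) in
  let a := D1 A x y in let b := D2 A x y in let c := D2 B x y in let d := D2 C x y in
  let p := D1 u x y in let q := D2 u x y in
  let s := 1 + p ^ 2 + q ^ 2 in
  let q1 := p * A x y + q * B x y in
  let q2 := p * B x y + q * C x y in
  a * C x y + A x y * c - 2 * B x y * b = D1 f x y * s ^ 2 + 4 * f x y * s * q1 /\
  b * C x y + A x y * d - 2 * B x y * c = D2 f x y * s ^ 2 + 4 * f x y * s * q2 /\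
  C x y * (D1 (D1 A) x y + D1 (D1 C) x y) - 2 * B x y * (D2 (D1 A) x y + D2 (D1 C) x y)
    + A x y * (D2 (D2 A) x y + D2 (D2 C) x y)
    + 2 * (a * c - b ^ 2 + b * d - c ^ 2) =
    (D1 (D1 f) x y + D2 (D2 f) x y) * s ^ 2 + 8 * s * (D1 f x y * q1 + D2 f x y * q2)
    + 8 * f x y * (q1 ^ 2 + q2 ^ 2)
    + 4 * f x y * s * (A x y ^ 2 + 2 * B x y ^ 2 + C x y ^ 2 + p * (a + c) + q * (b + d)).
Proof.
  intros Hu Hf HE Bxy A B C a b c d p q s q1 q2.
  pose proof (C_on_ball_D1 _ _ _ Hu) as Hp. pose proof (C_on_ball_D2 _ _ _ Hu) as Hq.
  pose proof (C_on_ball_D1 _ _ _ Hp : C_on_ball 2 r A) as HA.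
  pose proof (C_on_ball_D2 _ _ _ Hp : C_on_ball 2 r B) as HB.
  pose proof (C_on_ball_D2 _ _ _ Hq : C_on_ball 2 r C) as HC.
  apply C_on_ball_pred in Hp. apply C_on_ball_pred in Hq.
  pose proof (in_ball_open r x y Bxy) as Hop.
  destruct (curvature_equation_1d _ _ _ _ _ _ _ _ _ _ _ _ _ _ _ _ _ _ x
    (jet2_D1 r A x y HA Bxy) (jet2_D1 r B x y HB Bxy) (jet2_D1 r C x y HC Bxy)
    (jet2_D1 r f x y Hf Bxy) (jet2_D1 r _ x y Hp Bxy) (jet2_D1 r _ x y Hq Bxy)) as [X1 X2].
  { generalize (locally_2d_1d_const_y _ _ _ Hop). apply filter_imp.
    intros z Bz. now apply (curvature_equation_poly r). }
  destruct (curvature_equation_1d _ _ _ _ _ _ _ _ _ _ _ _ _ _ _ _ _ _ y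
    (jet2_D2 r A x y HA Bxy) (jet2_D2 r B x y HB Bxy) (jet2_D2 r C x y HC Bxy)
    (jet2_D2 r f x y Hf Bxy) (jet2_D2 r _ x y Hp Bxy) (jet2_D2 r _ x y Hq Bxy)) as [Y1 Y2].
  { generalize (locally_2d_1d_const_x _ _ _ Hop). apply filter_imp.
    intros z Bz. now apply (curvature_equation_poly r). }
  cbv beta zeta in X1, X2, Y1, Y2.
  assert (E12 : D1 (D2 u) x y = B x y) by exact (D12_comm 2 r u x y Hu Bxy).
  assert (EB1 : D1 B x y = b) by now apply (third_comm_112 r).
  assert (EC1 : D1 C x y = c) by now apply (third_comm_122 r).
  assert (EB11 : D1 (D1 B) x y = D2 (D1 A) x y).
  { rewrite <- (D12_comm 0 r A x y HA Bxy). apply (D1_ext_ball r); [|exact Bxy].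
    intros; now apply (third_comm_112 r). }
  assert (EC11 : D1 (D1 C) x y = D2 (D2 A) x y).
  { transitivity (D1 (D2 B) x y); [apply (D1_ext_ball r); [|exact Bxy]; intros; now apply (third_comm_122 r)|].
    rewrite (D12_comm 0 r B x y HB Bxy). apply (D2_ext_ball r); [|exact Bxy].
    intros; now apply (third_comm_112 r). }
  assert (EB22 : D2 (D2 B) x y = D2 (D1 C) x y).
  { apply (D2_ext_ball r); [|exact Bxy]. intros; symmetry; now apply (third_comm_122 r). }
  assert (Ep11 : D1 (D1 (D1 u)) x y = a) by reflexivity.
  assert (Ep22 : D2 (D2 (D1 u)) x y = c) by reflexivity.
  assert (Eq11 : D1 (D1 (D2 u)) x y = b).
  { rewrite <- EB1. apply (D1_ext_ball r); [|exact Bxy]. intros; now apply (D12_comm 2 r). }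
  assert (Eq22 : D2 (D2 (D2 u)) x y = d) by reflexivity.
  change (D1 (D1 u) x y) with (A x y) in *. change (D2 (D1 u) x y) with (B x y) in *.
  change (D2 (D2 u) x y) with (C x y) in *.
  rewrite E12, EB1, EC1 in X1, X2. rewrite EB11, EC11, Ep11, Eq11 in X2.
  rewrite EB22, Ep22, Eq22 in Y2.
  rewrite EC11.
  fold a b c d p q s in X1, X2, Y1, Y2.
  repeat split.
  - rewrite X1. unfold q1. ring.
  - rewrite Y1. unfold q2. ring.
  - unfold q1, q2. lra.
Qed.

(** * Algebra at a maximum point *)

(** The bilinear form of the cofactor matrix of the Hessian with rows [(A, B)] and
    [(B, C)]. *)
Definition cof_form (A B C x1 x2 y1 y2 : R) : R :=
  C * x1 * y1 - B * (x1 * y2 + x2 * y1) + A * x2 * y2.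

(** With the gradient [(g1, g2)] of [psi] given, the two differentiated equations are two
    linear relations between the four third derivatives [a], [b], [c], [d] and the
    gradient [(a + c, b + d)] of the Laplacian.  Solving for [b] and [c] in terms of the
    latter involves, up to sign, the determinant
    [(A - C)^2 + 4 B^2 = (A + C)^2 - 4 (A C - B^2)], the
    factor on the left.  For [g1 = g2 = 0] the quadratic term is thus a multiple of
    the cofactor form of the gradient of the Laplacian. *)
Lemma third_order_identity A B C a b c d g1 g2 :
  a * C + A * c - 2 * B * b = g1 ->
  b * C + A * d - 2 * B * c = g2 ->
  ((A + C) ^ 2 - 4 * (A * C - B ^ 2)) * (2 * (b ^ 2 + c ^ 2 - a * c - b * d)) =
  2 * (A + C) * cof_form A B C (a + c) (b + d) (a + c) (b + d)
  - 2 * ((A + C) * (g1 * (a + c) + g2 * (b + d)) + 2 * cof_form A B C g1 g2 (a + c) (b + d))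
  + 4 * (g1 ^ 2 + g2 ^ 2).
Proof. intros <- <-. unfold cof_form. ring. Qed.

Lemma cof_form_ge0 A B C x y :
  0 < A -> 0 <= A * C - B ^ 2 -> 0 <= cof_form A B C x y x y.
Proof.
  intros HA HD. apply Rmult_le_reg_l with A; [exact HA|].
  rewrite Rmult_0_r. unfold cof_form.
  replace (A * (C * x * x - B * (x * y + y * x) + A * y * y))
    with ((A * C - B ^ 2) * x ^ 2 + (A * y - B * x) ^ 2) by ring.
  pose proof (pow2_ge_0 x). pose proof (pow2_ge_0 (A * y - B * x)). nra.
Qed.

(** The factor [T^2 / S >= 1] in front of the cofactor form of [DT], coming from
    [third_order_identity], absorbs the cross term of [N (T * eta)], which by the
    first-order condition [eta DT = - T D eta] is nonpositive.  What remains involves [DT]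
    only through the linear terms, where it is traded for [D eta]. *)
Lemma max_point_reduced A B C a b c d g1 g2 eta e1 e2 lap psi NT :
  let T := A + C in
  let S := T ^ 2 - 4 * psi in
  0 < A -> 0 < C -> A * C - B ^ 2 = psi -> 0 <= psi -> 0 < eta -> 0 <= S ->
  a * C + A * c - 2 * B * b = g1 ->
  b * C + A * d - 2 * B * c = g2 ->
  NT + 2 * (a * c - b ^ 2 + b * d - c ^ 2) = lap ->
  (a + c) * eta + T * e1 = 0 ->
  (b + d) * eta + T * e2 = 0 ->
  eta * NT + 2 * cof_form A B C (a + c) (b + d) e1 e2 - 2 * psi * T <= 0 ->
  S * (eta * lap) <=
    2 * psi * T * S - 2 * T * (T * (g1 * e1 + g2 * e2) + 2 * cof_form A B C g1 g2 e1 e2).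
Proof.
  intros T S HA HC Hpsi Hpsi0 Heta HS H1 H2 HN G1 G2 HM.
  pose proof (third_order_identity A B C a b c d g1 g2 H1 H2) as HI.
  rewrite Hpsi in HI. fold T S in HI.
  set (t1 := a + c) in *. set (t2 := b + d) in *.
  apply Rmult_le_reg_l with eta; [exact Heta|].
  assert (E1 : t1 = - (T * e1 / eta)) by (apply Rmult_eq_reg_r with eta; [field_simplify; lra|lra]).
  assert (E2 : t2 = - (T * e2 / eta)) by (apply Rmult_eq_reg_r with eta; [field_simplify; lra|lra]).
  assert (Q1 : eta ^ 2 * cof_form A B C t1 t2 t1 t2 = T ^ 2 * cof_form A B C e1 e2 e1 e2).
  { rewrite E1, E2. unfold cof_form. field. lra. }
  assert (Q2 : eta * cof_form A B C t1 t2 e1 e2 = - T * cof_form A B C e1 e2 e1 e2).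
  { rewrite E1, E2. unfold cof_form. field. lra. }
  assert (Q3 : eta * cof_form A B C g1 g2 t1 t2 = - T * cof_form A B C g1 g2 e1 e2).
  { rewrite E1, E2. unfold cof_form. field. lra. }
  assert (Q4 : eta * (g1 * t1 + g2 * t2) = - T * (g1 * e1 + g2 * e2)).
  { rewrite E1, E2. field. lra. }
  pose proof (cof_form_ge0 A B C e1 e2 HA ltac:(lra)) as Qe.
  set (qe := cof_form A B C e1 e2 e1 e2) in *.
  set (X := T * (g1 * e1 + g2 * e2) + 2 * cof_form A B C g1 g2 e1 e2).
  assert (HI2 : eta ^ 2 * (S * (2 * (b ^ 2 + c ^ 2 - a * c - b * d))) =
    2 * T * (T ^ 2 * qe) + 2 * eta * T * X + 4 * eta ^ 2 * (g1 ^ 2 + g2 ^ 2)).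
  { rewrite HI, <- Q1. unfold X.
    replace (2 * eta * T * (T * (g1 * e1 + g2 * e2) + 2 * cof_form A B C g1 g2 e1 e2))
     with (- 2 * eta * (T * (- T * (g1 * e1 + g2 * e2)) + 2 * (- T * cof_form A B C g1 g2 e1 e2))) by ring.
    rewrite <- Q3, <- Q4. ring. }
  assert (HM2 : S * (eta * (eta * NT + 2 * cof_form A B C t1 t2 e1 e2 - 2 * psi * T)) <= 0).
  { replace 0 with (S * (eta * 0)) by ring. apply Rmult_le_compat_l; [exact HS|].
    apply Rmult_le_compat_l; lra. }
  replace (S * (eta * (eta * NT + 2 * cof_form A B C t1 t2 e1 e2 - 2 * psi * T)))
    with (eta ^ 2 * (S * NT) + 2 * S * (eta * cof_form A B C t1 t2 e1 e2) - 2 * psi * T * S * eta) in HM2 by ring.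
  rewrite Q2 in HM2.
  replace NT with (lap + 2 * (b ^ 2 + c ^ 2 - a * c - b * d)) in HM2 by (rewrite <- HN; ring).
  rewrite (Rmult_plus_distr_l S), (Rmult_plus_distr_l (eta ^ 2)), HI2 in HM2.
  assert (0 <= 2 * T * qe * (4 * psi)).
  { apply Rmult_le_pos; [apply Rmult_le_pos|]; unfold T; lra. }
  assert (HTS : T ^ 2 - S = 4 * psi) by (unfold S; ring).
  assert (0 <= 4 * eta ^ 2 * (g1 ^ 2 + g2 ^ 2)) by nra.
  fold X.
  replace (eta * (S * (eta * lap))) with (eta ^ 2 * (S * lap)) by ring.
  rewrite <- HTS in *. lra.
Qed.

Lemma Rabs_mult_le x y X Y : Rabs x <= X -> Rabs y <= Y -> Rabs (x * y) <= X * Y.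
Proof. intros. rewrite Rabs_mult. apply Rmult_le_compat; auto using Rabs_pos. Qed.

Lemma Rabs_plus_le x y X Y : Rabs x <= X -> Rabs y <= Y -> Rabs (x + y) <= X + Y.
Proof. intros. eapply Rle_trans; [apply Rabs_triang|lra]. Qed.

Lemma dot_le x1 x2 y1 y2 X Y :
  Rabs x1 <= X -> Rabs x2 <= X -> Rabs y1 <= Y -> Rabs y2 <= Y ->
  Rabs (x1 * y1 + x2 * y2) <= 2 * (X * Y).
Proof.
  intros. replace (2 * (X * Y)) with (X * Y + X * Y) by ring.
  apply Rabs_plus_le; now apply Rabs_mult_le.
Qed.

Lemma cof_form_le A B C x1 x2 y1 y2 T X Y :
  Rabs A <= T -> Rabs B <= T -> Rabs C <= T ->
  Rabs x1 <= X -> Rabs x2 <= X -> Rabs y1 <= Y -> Rabs y2 <= Y ->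
  Rabs (cof_form A B C x1 x2 y1 y2) <= 4 * (T * X * Y).
Proof.
  intros. unfold cof_form, Rminus.
  replace (4 * (T * X * Y)) with (T * X * Y + T * (X * Y + X * Y) + T * X * Y) by ring.
  repeat first [apply Rabs_plus_le | rewrite Rabs_Ropp | apply Rabs_mult_le]; assumption.
Qed.

(** The first summand covers the case where [T] is too small for [T ^ 2] to dominate
    [psi]; the second one is the outcome of the maximum principle otherwise. *)
Definition max_point_const (m M F1 F2 U G del : R) : R :=
  let sM := 1 + 2 * U ^ 2 in
  let psiM := M * sM ^ 2 in
  let k1 := sM ^ 2 * F1 + 8 * M * sM * U in
  del * (1 + 8 * psiM)
  + (2 * psiM + 40 * k1 * G + del * (F2 * sM ^ 2 + 32 * sM * F1 * U) + 8 * M * sM * U * G)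
    / (2 * m).

(** In the Laplacian of [psi] the term [4 f s (A^2 + 2 B^2 + C^2)] is at least [2 m T^2]
    for large [T]; the other terms are nonnegative or at most linear in
    [T] once the first-order conditions have turned [eta DT] into [- T D eta].  So [eta T^2] is bounded by a
    multiple of [T]. *)
Lemma max_point_bound (m M F1 F2 U G del : R) :
  0 < m -> 0 <= M -> 0 <= F1 -> 0 <= F2 -> 0 <= U -> 0 <= G -> 0 <= del ->
  forall A B C a b c d f f1 f2 lf p q eta e1 e2 NT,
  let T := A + C in
  let s := 1 + p ^ 2 + q ^ 2 in
  let q1 := p * A + q * B in
  let q2 := p * B + q * C in
  0 < A -> 0 < C -> m <= f <= M -> Rabs f1 <= F1 -> Rabs f2 <= F1 -> Rabs lf <= F2 ->
  Rabs p <= U -> Rabs q <= U -> 0 < eta <= del -> Rabs e1 <= G -> Rabs e2 <= G ->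
  A * C - B ^ 2 = f * s ^ 2 ->
  a * C + A * c - 2 * B * b = f1 * s ^ 2 + 4 * f * s * q1 ->
  b * C + A * d - 2 * B * c = f2 * s ^ 2 + 4 * f * s * q2 ->
  NT + 2 * (a * c - b ^ 2 + b * d - c ^ 2) =
    lf * s ^ 2 + 8 * s * (f1 * q1 + f2 * q2) + 8 * f * (q1 ^ 2 + q2 ^ 2)
    + 4 * f * s * (A ^ 2 + 2 * B ^ 2 + C ^ 2 + p * (a + c) + q * (b + d)) ->
  (a + c) * eta + T * e1 = 0 ->
  (b + d) * eta + T * e2 = 0 ->
  eta * NT + 2 * cof_form A B C (a + c) (b + d) e1 e2 - 2 * (f * s ^ 2) * T <= 0 ->
  eta * T <= max_point_const m M F1 F2 U G del.
Proof.
  intros Hm HM HF1 HF2 HU HG Hdel A B C a b c d f f1 f2 lf p q eta e1 e2 NT T s q1 q2 HA HC Hf Hf1 Hf2 Hlf Hp Hq Heta He1 He2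
    E0 E1 E2 E3 G1 G2 HMx.
  unfold max_point_const.
  set (sM := 1 + 2 * U ^ 2). set (psiM := M * sM ^ 2).
  set (k1 := sM ^ 2 * F1 + 8 * M * sM * U).
  set (K2 := 2 * psiM + 40 * k1 * G + del * (F2 * sM ^ 2 + 32 * sM * F1 * U) + 8 * M * sM * U * G).
  assert (Hs : 1 <= s <= sM).
  { unfold s, sM. apply Rabs_le_between in Hp. apply Rabs_le_between in Hq. nra. }
  assert (Hs2 : 1 <= s ^ 2 <= sM ^ 2) by nra.
  set (psi := f * s ^ 2) in *.
  assert (Hpsi : m <= psi <= psiM).
  { unfold psi, psiM. split; [nra|]. apply Rmult_le_compat; nra. }
  assert (HT0 : 0 < T) by (unfold T; lra).
  assert (Hk1 : 0 <= k1).
  { unfold k1. assert (0 <= sM ^ 2 * F1) by nra. assert (0 <= M * sM) by nra. nra. }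
  assert (HMsU : 0 <= M * sM * U) by (apply Rmult_le_pos; nra).
  assert (HFs : 0 <= F2 * sM ^ 2 + 32 * sM * F1 * U).
  { assert (0 <= sM * F1) by nra. nra. }
  assert (HK2 : 0 <= K2).
  { unfold K2. assert (0 <= k1 * G) by nra. assert (0 <= M * sM * U * G) by nra. nra. }
  assert (HK2m : 0 <= K2 / (2 * m)) by (apply Rdiv_le_0_compat; lra).
  destruct (Rle_lt_dec T (1 + 8 * psiM)) as [Hsmall|Hlarge].
  { assert (eta * T <= del * (1 + 8 * psiM)) by (apply Rmult_le_compat; lra). lra. }
  assert (HT1 : 1 <= T) by lra.
  assert (HT8 : 8 * psi <= T ^ 2) by nra.
  set (S := T ^ 2 - 4 * psi).
  assert (HS : T ^ 2 <= 2 * S) by (unfold S; lra).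
  assert (HS0 : 0 < S) by nra.
  pose proof (max_point_reduced A B C a b c d _ _ eta e1 e2 _ psi NT HA HC E0 ltac:(lra)
    (proj1 Heta) (Rlt_le _ _ HS0) E1 E2 E3 G1 G2 HMx) as HR.
  fold T S in HR.
  set (g1 := f1 * s ^ 2 + 4 * f * s * q1) in *.
  set (g2 := f2 * s ^ 2 + 4 * f * s * q2) in *.
  assert (HAa : Rabs A <= T) by (rewrite Rabs_pos_eq; unfold T; lra).
  assert (HCa : Rabs C <= T) by (rewrite Rabs_pos_eq; unfold T; lra).
  assert (HBa : Rabs B <= T).
  { apply Rabs_le. assert (B ^ 2 <= T ^ 2) by (unfold T; nra). nra. }
  assert (Hq1 : Rabs q1 <= 2 * U * T).
  { replace (2 * U * T) with (U * T + U * T) by ring. apply Rabs_plus_le; now apply Rabs_mult_le. }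
  assert (Hq2 : Rabs q2 <= 2 * U * T).
  { replace (2 * U * T) with (U * T + U * T) by ring. apply Rabs_plus_le; now apply Rabs_mult_le. }
  assert (Hsa : Rabs s <= sM) by (rewrite Rabs_pos_eq; lra).
  assert (Hs2a : Rabs (s ^ 2) <= sM ^ 2) by (rewrite Rabs_pos_eq; lra).
  assert (Hfa : Rabs f <= M) by (rewrite Rabs_pos_eq; lra).
  assert (H4fs : Rabs (4 * f * s) <= 4 * M * sM).
  { apply Rabs_mult_le; [apply Rabs_mult_le|]; auto. rewrite Rabs_pos_eq; lra. }
  assert (HF1T : F1 * sM ^ 2 + 4 * M * sM * (2 * U * T) <= k1 * T).
  { unfold k1. assert (F1 * sM ^ 2 <= F1 * sM ^ 2 * T) by (rewrite <- (Rmult_1_r (F1 * sM ^ 2)) at 1; apply Rmult_le_compat_l; nra). lra. }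
  assert (Hg1 : Rabs g1 <= k1 * T).
  { apply Rle_trans with (2 := HF1T). apply Rabs_plus_le; apply Rabs_mult_le; auto. }
  assert (Hg2 : Rabs g2 <= k1 * T).
  { apply Rle_trans with (2 := HF1T). apply Rabs_plus_le; apply Rabs_mult_le; auto. }
  set (X := T * (g1 * e1 + g2 * e2) + 2 * cof_form A B C g1 g2 e1 e2) in *.
  assert (HTa : Rabs T <= T) by (rewrite Rabs_pos_eq; lra).
  assert (HX : Rabs X <= 10 * (k1 * G) * T ^ 2).
  { replace (10 * (k1 * G) * T ^ 2) with
      (T * (2 * (k1 * T * G)) + 2 * (4 * (T * (k1 * T) * G))) by ring.
    apply Rabs_plus_le; apply Rabs_mult_le; auto using dot_le, cof_form_le.
    rewrite Rabs_pos_eq; lra. }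
  set (lap := lf * s ^ 2 + _ + _ + _) in *.
  assert (H1 : eta * lap <= (2 * psiM + 40 * (k1 * G)) * T).
  { apply Rmult_le_reg_l with S; [exact HS0|]. apply Rle_trans with (1 := HR).
    apply Rabs_le_between in HX.
    assert (2 * T * - X <= 2 * T * (10 * (k1 * G) * T ^ 2)) by (apply Rmult_le_compat_l; lra).
    assert (2 * T * (10 * (k1 * G) * T ^ 2) <= 2 * T * (10 * (k1 * G) * (2 * S))).
    { apply Rmult_le_compat_l; [lra|]. apply Rmult_le_compat_l; [|lra].
      assert (0 <= k1 * G) by (apply Rmult_le_pos; lra). lra. }
    assert (2 * psi * T * S <= 2 * psiM * T * S).
    { apply Rmult_le_compat_r; [lra|]. apply Rmult_le_compat_r; lra. }
    lra. }
  assert (HAC : A ^ 2 + 2 * B ^ 2 + C ^ 2 = T ^ 2 - 2 * psi) by (unfold T; rewrite <- E0; ring).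
  assert (Elap : eta * lap = eta * (lf * s ^ 2 + 8 * s * (f1 * q1 + f2 * q2))
      + eta * (8 * f * (q1 ^ 2 + q2 ^ 2)) + eta * (4 * f * s * (T ^ 2 - 2 * psi))
      - T * (4 * f * s * (p * e1 + q * e2))).
  { unfold lap. rewrite HAC.
    transitivity (eta * (lf * s ^ 2 + 8 * s * (f1 * q1 + f2 * q2))
      + eta * (8 * f * (q1 ^ 2 + q2 ^ 2)) + eta * (4 * f * s * (T ^ 2 - 2 * psi))
      + 4 * f * s * (p * ((a + c) * eta) + q * ((b + d) * eta))); [ring|].
    replace ((a + c) * eta) with (- (T * e1)) by lra.
    replace ((b + d) * eta) with (- (T * e2)) by lra. ring. }
  assert (L1 : - (del * (F2 * sM ^ 2 + 32 * sM * F1 * U) * T) <= eta * (lf * s ^ 2 + 8 * s * (f1 * q1 + f2 * q2))).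
  { assert (Hr : Rabs (lf * s ^ 2 + 8 * s * (f1 * q1 + f2 * q2)) <= (F2 * sM ^ 2 + 32 * sM * F1 * U) * T).
    { apply Rle_trans with (F2 * sM ^ 2 + 8 * sM * (2 * (F1 * (2 * U * T)))).
      - apply Rabs_plus_le; [now apply Rabs_mult_le|].
        apply Rabs_mult_le; [|now apply dot_le].
        apply Rabs_mult_le; [rewrite Rabs_pos_eq; lra|exact Hsa].
      - assert (F2 * sM ^ 2 * 1 <= F2 * sM ^ 2 * T) by
          (apply Rmult_le_compat_l; [apply Rmult_le_pos; lra|lra]). lra. }
    assert (Hr2 : Rabs (eta * (lf * s ^ 2 + 8 * s * (f1 * q1 + f2 * q2))) <= del * ((F2 * sM ^ 2 + 32 * sM * F1 * U) * T)).
    { apply Rabs_mult_le; [rewrite Rabs_pos_eq; lra|exact Hr]. }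
    apply Rabs_le_between in Hr2. lra. }
  assert (L2 : 0 <= eta * (8 * f * (q1 ^ 2 + q2 ^ 2))).
  { apply Rmult_le_pos; [lra|]. apply Rmult_le_pos; [lra|].
    pose proof (pow2_ge_0 q1). pose proof (pow2_ge_0 q2). lra. }
  assert (L3 : 2 * m * (eta * T ^ 2) <= eta * (4 * f * s * (T ^ 2 - 2 * psi))).
  { assert (f * 1 <= f * s) by (apply Rmult_le_compat_l; lra).
    assert (m * (T ^ 2 / 2) <= f * s * (T ^ 2 - 2 * psi)) by
      (apply Rmult_le_compat; lra).
    assert (eta * (m * (T ^ 2 / 2)) <= eta * (f * s * (T ^ 2 - 2 * psi))) by (apply Rmult_le_compat_l; lra).
    lra. }
  assert (L4 : T * (4 * f * s * (p * e1 + q * e2)) <= 8 * M * sM * U * G * T).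
  { apply Rle_trans with (1 := Rle_abs _).
    replace (8 * M * sM * U * G * T) with (T * (4 * M * sM * (U * G + U * G))) by ring.
    apply Rabs_mult_le; [exact HTa|]. apply Rabs_mult_le; [exact H4fs|].
    apply Rabs_plus_le; now apply Rabs_mult_le. }
  assert (Hfin : 2 * m * (eta * T) <= K2).
  { apply Rmult_le_reg_r with T; [exact HT0|]. unfold K2. lra. }
  assert (eta * T <= K2 / (2 * m)).
  { apply Rmult_le_reg_l with (2 * m); [lra|].
    replace (2 * m * (K2 / (2 * m))) with K2 by (field; lra). exact Hfin. }
  assert (0 <= del * (1 + 8 * psiM)) by (apply Rmult_le_pos; lra). lra.
Qed.

(** * The interior estimate *)

(** The restriction of [T * eta] to a line in direction [(v, w)] has a maximum, and
    [jet2_mult] gives its first two derivatives; [(t1, t2)] and [(e1, e2)] are the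
    gradients of [T] and [eta]. *)
Lemma max_point_conditions r u u0 P1 P2 del x y :
  C_on_ball 4 r u -> in_ball r x y ->
  let A := D1 (D1 u) in let B := D2 (D1 u) in let C := D2 (D2 u) in
  let eta := fun x y => del - (u x y - (u0 + P1 * x + P2 * y)) in
  locally_2d (fun a b => (A a b + C a b) * eta a b <= (A x y + C x y) * eta x y) x y ->
  let t1 := D1 A x y + D1 C x y in let t2 := D2 A x y + D2 C x y in
  let e1 := P1 - D1 u x y in let e2 := P2 - D2 u x y in
  forall v w,
  (t1 * v + t2 * w) * eta x y + (A x y + C x y) * (e1 * v + e2 * w) = 0 /\
  (hess_form A x y v w + hess_form C x y v w) * eta x y
    + 2 * (t1 * v + t2 * w) * (e1 * v + e2 * w)
    - (A x y + C x y) * hess_form u x y v w <= 0.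
Proof.
  intros Hu Bxy A B C eta Hmax t1 t2 e1 e2 v w.
  pose proof (C_on_ball_D1 _ _ _ (C_on_ball_D1 _ _ _ Hu) : C_on_ball 2 r A) as HA.
  pose proof (C_on_ball_D2 _ _ _ (C_on_ball_D2 _ _ _ Hu) : C_on_ball 2 r C) as HC.
  pose proof (C_on_ball_pred _ _ _ (C_on_ball_pred _ _ _ Hu)) as Hu2.
  assert (Haff : jet2 (fun s => del + (u0 + P1 * (x + s * v) + P2 * (y + s * w)))
    (fun s => P1 * v + P2 * w) 0 0).
  { split.
    - apply filter_forall. intros s. auto_derive; [easy|ring].
    - apply (is_derive_const (V := R_NormedModule)). }
  pose proof (jet2_mult _ _ _ _ _ _ _
    (jet2_plus _ _ _ _ _ _ _ (jet2_line r A x y v w HA Bxy) (jet2_line r C x y v w HC Bxy))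
    (jet2_minus _ _ _ _ _ _ _ Haff (jet2_line r u x y v w Hu2 Bxy))) as J.
  destruct (second_derivative_test _ _ _ J) as [Z N].
  { generalize (locally_2d_line _ x y v w Hmax). apply filter_imp. intros s Hs.
    unfold eta in Hs. rewrite !Rmult_0_l, !Rplus_0_r. lra. }
  rewrite !Rmult_0_l, !Rplus_0_r in Z, N. unfold t1, t2, e1, e2, eta. lra.
Qed.

Lemma hess_trace_bound (r m M F1 F2 U : R) :
  0 < r -> 0 < m -> 0 <= M -> 0 <= F1 -> 0 <= F2 -> 0 <= U ->
  exists K, 0 < K /\ forall f u,
    C_on_ball 2 r f -> C_on_ball 4 r u -> convex_on_ball r u ->
    gauss_curvature_eq r u f ->
    (forall x y, in_ball r x y -> m <= f x y <= M) ->
    (forall x y, in_ball r x y -> Rabs (D1 f x y) <= F1 /\ Rabs (D2 f x y) <= F1 /\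
       Rabs (D1 (D1 f) x y + D2 (D2 f) x y) <= F2) ->
    (forall x y, in_ball r x y -> grad_norm u x y <= U) ->
    D1 (D1 u) 0 0 + D2 (D2 u) 0 0 <= K.
Proof.
  intros Hr Hm HM HF1 HF2 HU.
  destruct (uniform_strict_convexity r m (2 * U + 1) Hr Hm ltac:(lra)) as [del [Hdel Hstrict]].
  set (K := max_point_const m M F1 F2 U (2 * U) del).
  exists (Rabs K / del + 1). split.
  { assert (0 <= Rabs K / del) by (apply Rdiv_le_0_compat; [apply Rabs_pos|exact Hdel]). lra. }
  intros f u Hf Hu Hc HE Hfm HfF HuU.
  pose proof (C_on_ball_pred _ _ _ (C_on_ball_pred _ _ _ Hu)) as Hu2.
  assert (HEp := fun x y => curvature_equation_poly r u f x y Hu HE).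
  assert (Hdet : forall x y, in_ball r x y ->
    m <= D1 (D1 u) x y * D2 (D2 u) x y - D2 (D1 u) x y ^ 2).
  { intros x y B. rewrite (HEp x y B). destruct (Hfm x y B) as [Hf1 _].
    pose proof (pow2_ge_0 (D1 u x y)). pose proof (pow2_ge_0 (D2 u x y)).
    assert (1 <= (1 + D1 u x y ^ 2 + D2 u x y ^ 2) ^ 2) by nra. nra. }
  assert (Hpos : forall x y, in_ball r x y -> 0 < D1 (D1 u) x y /\ 0 < D2 (D2 u) x y).
  { intros x y B. specialize (Hdet x y B).
    pose proof (convex_hess_form_ge0 r u x y 1 0 Hu2 Hc B) as H1.
    pose proof (convex_hess_form_ge0 r u x y 0 1 Hu2 Hc B) as H2.
    unfold hess_form in H1, H2. split; nra. }
  assert (B0 : in_ball r 0 0) by (apply in_ball_sqr; [exact Hr|nra]).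
  set (u0 := u 0 0). set (P1 := D1 u 0 0). set (P2 := D2 u 0 0).
  set (T := fun x y => D1 (D1 u) x y + D2 (D2 u) x y).
  set (eta := fun x y => del - (u x y - (u0 + P1 * x + P2 * y))).
  assert (Hsq : forall x y, - (r / 2) <= x <= r / 2 -> - (r / 2) <= y <= r / 2 -> in_ball r x y).
  { intros x y Hx Hy. apply in_ball_sqr; [exact Hr|]. nra. }
  destruct (rectangle_max (fun x y => T x y * eta x y) (- (r / 2)) (r / 2) (- (r / 2)) (r / 2))
    as (x & y & [Hx Hy] & Hmax); try lra.
  { intros x y Hx Hy. pose proof (Hsq x y Hx Hy) as B.
    apply continuity_2d_pt_mult.
    - apply continuity_2d_pt_plus; apply (C_on_ball_continuity 2 r); auto.
      + now do 2 apply C_on_ball_D1.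
      + now do 2 apply C_on_ball_D2.
    - unfold eta. apply continuity_2d_pt_minus; [apply continuity_2d_pt_const|].
      apply continuity_2d_pt_minus; [now apply (C_on_ball_continuity 2 r)|].
      apply continuity_2d_pt_plus; [apply continuity_2d_pt_plus; [apply continuity_2d_pt_const|]|];
      apply continuity_2d_pt_mult;
      auto using continuity_2d_pt_const, continuity_2d_pt_id1, continuity_2d_pt_id2. }
  pose proof (Hsq x y Hx Hy) as B. destruct (Hpos x y B) as [HA HC].
  destruct (Hpos 0 0 B0) as [HA0 HC0].
  assert (H00 : T 0 0 * del <= T x y * eta x y).
  { replace del with (eta 0 0) by (unfold eta, u0; ring). apply (Hmax 0 0); lra. }
  assert (HT0 : 0 < T 0 0) by (unfold T; lra).
  assert (HTx : 0 < T x y) by (unfold T; lra).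
  assert (Heta : 0 < eta x y) by nra.
  assert (Hetadel : eta x y <= del).
  { pose proof (convex_above_tangent r u 0 0 x y (C_on_ball_pred _ _ _ Hu2) Hc B0 B). unfold eta, u0, P1, P2. lra. }
  assert (Hin : in_ball (r / 2) x y).
  { apply Rnot_le_lt. intros Hn.
    assert (Hs := Hstrict u Hu2 Hc Hdet ltac:(intros; eapply Rle_trans; [now apply HuU|lra]) x y B Hn).
    unfold eta, u0, P1, P2 in Heta. lra. }
  assert (Hloc : locally_2d (fun a b => T a b * eta a b <= T x y * eta x y) x y).
  { generalize (in_ball_open _ _ _ Hin). apply locally_2d_impl, locally_2d_forall.
    intros a b Bab. apply in_ball_sqr in Bab; [|lra].
    apply Hmax; split; nra. }
  pose proof (max_point_conditions r u u0 P1 P2 del x y Hu B Hloc) as Hcond.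
  destruct (Hcond 1 0) as [G1 M1]. destruct (Hcond 0 1) as [G2 _].
  destruct (Hcond (- D2 (D1 u) x y) (D1 (D1 u) x y)) as [_ M2].
  cbv zeta in G1, M1, G2, M2. fold (eta x y) in G1, M1, G2, M2.
  destruct (laplace_curvature_equation r u f x y Hu Hf HE B) as (E1 & E2 & E3).
  cbv zeta in E1, E2, E3.
  assert (Hgrad : forall x y, in_ball r x y -> Rabs (D1 u x y) <= U /\ Rabs (D2 u x y) <= U).
  { intros a b Bab. specialize (HuU a b Bab). unfold grad_norm, norm2 in HuU.
    split; (eapply Rle_trans; [|exact HuU]); rewrite <- sqrt_Rsqr_abs; apply sqrt_le_1_alt; unfold Rsqr; nra. }
  destruct (Hgrad x y B) as [Hp Hq]. destruct (Hgrad 0 0 B0) as [Hp0 Hq0].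
  destruct (HfF x y B) as (Hf1 & Hf2 & Hlf).
  assert (Hfin : eta x y * T x y <= K).
  { refine (max_point_bound m M F1 F2 U (2 * U) del Hm HM HF1 HF2 HU ltac:(lra) ltac:(lra)
      (D1 (D1 u) x y) (D2 (D1 u) x y) (D2 (D2 u) x y) (D1 (D1 (D1 u)) x y) (D2 (D1 (D1 u)) x y)
      (D2 (D2 (D1 u)) x y) (D2 (D2 (D2 u)) x y) (f x y) (D1 f x y) (D2 f x y) _
      (D1 u x y) (D2 u x y) (eta x y) (P1 - D1 u x y) (P2 - D2 u x y) _
      HA HC (Hfm x y B) Hf1 Hf2 Hlf Hp Hq (conj Heta Hetadel) _ _ (HEp x y B) E1 E2 E3 _ _ _).
    - eapply Rle_trans; [apply Rabs_triang|]. rewrite Rabs_Ropp. unfold P1. lra.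
    - eapply Rle_trans; [apply Rabs_triang|]. rewrite Rabs_Ropp. unfold P2. lra.
    - rewrite <- (third_comm_122 r u x y Hu B). lra.
    - lra.
    - rewrite <- (third_comm_122 r u x y Hu B), <- (HEp x y B). unfold hess_form in M1, M2.
      (* With [A > 0], [A N w] is [det] times the second derivative of [w] in direction
         [(1, 0)] plus its second derivative in direction [(- B, A)]. *)
      apply Rmult_le_reg_l with (D1 (D1 u) x y); [exact HA|]. rewrite Rmult_0_r.
      specialize (Hdet x y B).
      assert (M1' := Rmult_le_compat_l _ _ _ (Rle_trans _ _ _ (Rlt_le _ _ Hm) Hdet) M1).
      rewrite Rmult_0_r in M1'.
      unfold cof_form. lra. }
  apply Rmult_le_reg_r with del; [exact Hdel|].
  replace ((Rabs K / del + 1) * del) with (Rabs K + del) by (field; lra).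
  pose proof (Rle_abs K). change (T 0 0 * del <= Rabs K + del). lra.
Qed.

Theorem theorem1p1 :
  forall (r m M F1 F2 U1 : R),
    0 < r -> 0 < m ->
    exists K : R, 0 < K /\
      forall (f u : R -> R -> R),
        C_on_ball 2 r f ->
        (forall x y : R, in_ball r x y -> m <= f x y <= M) ->
        C_on_ball 4 r u ->
        convex_on_ball r u ->
        gauss_curvature_eq r u f ->
        is_sup_on_ball r (grad_norm f) F1 ->
        is_sup_on_ball r (hess_norm f) F2 ->
        is_sup_on_ball r (grad_norm u) U1 ->
        hess_norm u 0 0 <= K.
Proof.
  intros r m M F1 F2 U1 Hr Hm.
  destruct (hess_trace_bound r m (Rabs M) (Rabs F1) (2 * Rabs F2) (Rabs U1) Hr Hm)
    as (K & HK & Hmain); try (pose proof (Rabs_pos F2); auto using Rabs_pos; lra).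
  exists K. split; [exact HK|].
  intros f u Hf Hfm Hu Hc HE HF1 HF2 HU1.
  assert (Hsup : forall h S x y, is_sup_on_ball r h S -> in_ball r x y -> h x y <= Rabs S).
  { intros h S x y [HS _] B. apply Rle_trans with S; [|apply Rle_abs].
    apply HS. now exists x, y. }
  assert (Habs : forall a b : R, 0 <= b -> Rabs a <= sqrt (a ^ 2 + b)).
  { intros a b Hb. rewrite <- sqrt_Rsqr_abs. apply sqrt_le_1_alt. unfold Rsqr. lra. }
  assert (B0 : in_ball r 0 0) by (apply in_ball_sqr; [exact Hr|nra]).
  assert (HT := Hmain f u Hf Hu Hc HE).
  eapply Rle_trans; [|apply HT].
  - pose proof (C_on_ball_pred _ _ _ (C_on_ball_pred _ _ _ Hu)) as Hu2.
    pose proof (convex_hess_form_ge0 r u 0 0 1 0 Hu2 Hc B0) as H1.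
    pose proof (convex_hess_form_ge0 r u 0 0 0 1 Hu2 Hc B0) as H2.
    pose proof (curvature_equation_poly r u f 0 0 Hu HE B0) as E.
    destruct (Hfm 0 0 B0) as [Hf0 _].
    unfold hess_form in H1, H2. unfold hess_norm.
    rewrite (D12_comm 2 r u 0 0 Hu B0).
    set (A := D1 (D1 u) 0 0) in *. set (B := D2 (D1 u) 0 0) in *. set (C := D2 (D2 u) 0 0) in *.
    rewrite <- (sqrt_pow2 (A + C)) by lra. apply sqrt_le_1_alt.
    assert (0 <= A * C - B ^ 2) by (rewrite E; apply Rmult_le_pos; [lra|apply pow2_ge_0]).
    lra.
  - intros x y B. split; [now apply Hfm|]. apply Rle_trans with M; [now apply Hfm|apply Rle_abs].
  - intros x y B.
    pose proof (Hsup _ _ x y HF1 B) as HG. pose proof (Hsup _ _ x y HF2 B) as HH.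
    unfold grad_norm, norm2 in HG. unfold hess_norm in HH.
    pose proof (pow2_ge_0 (D1 f x y)). pose proof (pow2_ge_0 (D2 f x y)).
    pose proof (pow2_ge_0 (D1 (D1 f) x y)). pose proof (pow2_ge_0 (D1 (D2 f) x y)).
    pose proof (pow2_ge_0 (D2 (D1 f) x y)). pose proof (pow2_ge_0 (D2 (D2 f) x y)).
    split; [|split].
    + apply Rle_trans with (2 := HG). now apply Habs.
    + apply Rle_trans with (2 := HG). rewrite Rplus_comm. now apply Habs.
    + eapply Rle_trans; [apply Rabs_triang|].
      replace (2 * Rabs F2) with (Rabs F2 + Rabs F2) by ring.
      apply Rplus_le_compat; apply Rle_trans with (2 := HH).
      * rewrite !Rplus_assoc. apply Habs. lra.
      * rewrite Rplus_comm. apply Habs. lra.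
  - intros x y B. now apply Hsup.
Qed.
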